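(* Let $k$ be a field of characteristic different from $2$ and $3$. Then $kK_n=0$ for all $n\ge 5$.
   Context: $\Gamma_n$ is the group with generators $s_1,\dots,s_{n-1}$ and relations $s_is_j=s_js_i$ for $|i-j|\ge 2$, $s_is_{i+1}s_i=s_{i+1}s_is_{i+1}$ for $1\le i\le n-2$, and $s_i^3=1$. The kernel $Q$ of the morphism $\Gamma_3\to C_3$ sending $s_1,s_2$ to a fixed generator of the cyclic group $C_3$ is a quaternion group of order $8$. Put $\mathbf{q}=\sum_{g\in Q}g$, viewed in $k\Gamma_n$ ($n\ge3$) via the natural morphism $\Gamma_3\to\Gamma_n$. Then $kK_n$ denotes the quotient of $k\Gamma_n$ by the two-sided ideal generated by $\mathbf{q}$. *)

(* Defs.v *)
From HB Require Import structures.
From mathcomp Require Import all_boot all_order all_algebra all_fingroup.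
From mathcomp Require Import finmap generic_quotient ring_quotient.
From mathcomp Require Import boolp classical_sets cardinality fsbigop.
From mathcomp Require Import monalg.

Set Implicit Arguments.
Unset Strict Implicit.
Unset Printing Implicit Defensive.

Import GRing.Theory.

Local Open Scope classical_set_scope.
Local Open Scope quotient_scope.
Local Open Scope ring_scope.

(* Groups given by generators and relations. The letter (i, false) stands for
   the generator indexed by i and (i, true) for its inverse. *)
Definition word (I : Type) := seq (I * bool).

Section PresentedGroup.
Variables (I : choiceType) (rels : word I -> word I -> Prop).

Inductive pres_cong : word I -> word I -> Prop :=
| PresRel u v : rels u v -> pres_cong u v
| PresCancel i b : pres_cong [:: (i, b); (i, ~~ b)] [::]
| PresCat u u' v v' :
    pres_cong u u' -> pres_cong v v' -> pres_cong (u ++ v) (u' ++ v')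
| PresRefl u : pres_cong u u
| PresSym u v : pres_cong u v -> pres_cong v u
| PresTrans u v w : pres_cong u v -> pres_cong v w -> pres_cong u w.

Definition pres_eq (u v : word I) : bool := `[< pres_cong u v >].

Lemma pres_eq_refl : reflexive pres_eq.
Proof. by move=> u; apply/asboolP; exact: PresRefl. Qed.

Lemma pres_eq_sym : symmetric pres_eq.
Proof. by move=> u v; apply/asboolP/asboolP; exact: PresSym. Qed.

Lemma pres_eq_trans : transitive pres_eq.
Proof. by move=> v u w /asboolP uv /asboolP vw; apply/asboolP; exact: PresTrans vw. Qed.

Canonical pres_equiv := EquivRel pres_eq pres_eq_refl pres_eq_sym pres_eq_trans.

Definition pres_group := {eq_quot pres_equiv}.

HB.instance Definition _ := Choice.on pres_group.
HB.instance Definition _ := EqQuotient.on pres_group.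

Definition pres_class (w : word I) : pres_group := \pi_pres_group w.

Lemma pres_classP u v : pres_class u = pres_class v <-> pres_cong u v.
Proof.
by split=> [/eqmodP/asboolP//|uv]; apply/eqmodP/asboolP.
Qed.

Lemma pres_classK (x : pres_group) : pres_class (repr x) = x.
Proof. exact: reprK. Qed.

Definition word_inv (w : word I) : word I := rev [seq (l.1, ~~ l.2) | l <- w].

Lemma word_invK : involutive word_inv.
Proof.
move=> w; rewrite /word_inv map_rev revK -map_comp map_id_in //.
by move=> [i b] _ /=; rewrite negbK.
Qed.

Lemma word_invl w : pres_cong (word_inv w ++ w) [::].
Proof.
elim: w => [|[i b] w IH]; first exact: PresRefl.
rewrite /word_inv /= rev_cons cat_rcons; apply: PresTrans IH.
apply: PresCat; first exact: PresRefl.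
rewrite -[X in pres_cong _ X]cat0s -[_ :: _]/([:: (i, ~~ b); (i, b)] ++ w).
apply: PresCat; last exact: PresRefl.
by rewrite -{2}[b]negbK; exact: PresCancel.
Qed.

Lemma word_invr w : pres_cong (w ++ word_inv w) [::].
Proof. by rewrite -{1}[w]word_invK; exact: word_invl. Qed.

Lemma word_inv_cong u v : pres_cong u v -> pres_cong (word_inv u) (word_inv v).
Proof.
move=> uv; apply: (@PresTrans _ (word_inv u ++ (v ++ word_inv v))).
  rewrite -[X in pres_cong X]cats0; apply: PresCat; first exact: PresRefl.
  exact: PresSym (word_invr v).
rewrite catA -[X in pres_cong _ X]cat0s; apply: PresCat; last exact: PresRefl.
apply: PresTrans (word_invl u); apply: PresCat; first exact: PresRefl.
exact: PresSym.
Qed.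

Definition pres_one : pres_group := pres_class [::].
Definition pres_mul (x y : pres_group) := pres_class (repr x ++ repr y).
Definition pres_inv (x : pres_group) := pres_class (word_inv (repr x)).

Lemma pres_repr_class w : pres_cong (repr (pres_class w)) w.
Proof. by apply/pres_classP; rewrite pres_classK. Qed.

Lemma pres_mulE u v : pres_mul (pres_class u) (pres_class v) = pres_class (u ++ v).
Proof. by apply/pres_classP; apply: PresCat; exact: pres_repr_class. Qed.

Lemma pres_invE u : pres_inv (pres_class u) = pres_class (word_inv u).
Proof. by apply/pres_classP; apply: word_inv_cong; exact: pres_repr_class. Qed.

Lemma pres_mulA : associative pres_mul.
Proof.
move=> x y z; rewrite -[x]pres_classK -[y]pres_classK -[z]pres_classK.
by rewrite !pres_mulE catA.
Qed.

Lemma pres_mul1g : left_id pres_one pres_mul.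
Proof. by move=> x; rewrite -[x]pres_classK pres_mulE. Qed.

Lemma pres_mulg1 : right_id pres_one pres_mul.
Proof. by move=> x; rewrite -[x]pres_classK pres_mulE cats0. Qed.

Lemma pres_mulVg : left_inverse pres_one pres_inv pres_mul.
Proof.
move=> x; rewrite -[x]pres_classK pres_invE pres_mulE; apply/pres_classP.
exact: word_invl.
Qed.

Lemma pres_mulgV : right_inverse pres_one pres_inv pres_mul.
Proof.
move=> x; rewrite -[x]pres_classK pres_invE pres_mulE; apply/pres_classP.
exact: word_invr.
Qed.

HB.instance Definition _ :=
  isGroup.Build pres_group pres_mulA pres_mul1g pres_mulg1 pres_mulVg pres_mulgV.

Lemma pres_classM u v :
  (pres_class u * pres_class v)%g = pres_class (u ++ v) :> pres_group.
Proof. exact: pres_mulE. Qed.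

Lemma pres_class3 u v w : (pres_class u * pres_class v * pres_class w)%g
  = pres_class (u ++ v ++ w) :> pres_group.
Proof. by rewrite -mulgA (pres_classM v w) (pres_classM u). Qed.

Lemma pres_classV u : (pres_class u)^-1%g = pres_class (word_inv u) :> pres_group.
Proof. exact: pres_invE. Qed.

Definition pres_gen (i : I) : pres_group := pres_class [:: (i, false)].

End PresentedGroup.

Section PresentedGroupMorphism.
Variables (I : choiceType) (rels : word I -> word I -> Prop).
Variables (G : groupType) (f : I -> G).
Local Open Scope group_scope.

Definition word_eval (w : word I) : G :=
  \prod_(l <- w) (if l.2 then (f l.1)^-1 else f l.1).

Definition respects := forall u v, rels u v -> word_eval u = word_eval v.

Hypothesis hf : respects.

Definition pres_lift of respects := fun x : pres_group rels => word_eval (repr x).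

Lemma word_eval_cong u v : pres_cong rels u v -> word_eval u = word_eval v.
Proof.
elim=> {u v} [u v /hf//|i b|u u' v v' _ IH1 _ IH2|//|u v _ ->//|u v w _ -> _ ->//].
  by rewrite /word_eval !big_cons big_nil mulg1 /=; case: b => /=;
     rewrite ?mulVg ?mulgV.
by rewrite /word_eval !big_cat /= -/(word_eval _) -/(word_eval _) IH1 IH2.
Qed.

Lemma pres_lift_class w : pres_lift hf (pres_class rels w) = word_eval w.
Proof. by apply: word_eval_cong; exact: pres_repr_class. Qed.

Lemma pres_lift_gen i : pres_lift hf (pres_gen rels i) = f i.
Proof. by rewrite pres_lift_class /word_eval big_seq1. Qed.

Lemma pres_liftM : {morph pres_lift hf : x y / x * y}.
Proof.
move=> x y; rewrite -[x]pres_classK -[y]pres_classK.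
rewrite [_ * _]pres_mulE !pres_lift_class.
by rewrite /word_eval big_cat.
Qed.

Lemma pres_lift1 : pres_lift hf 1 = 1.
Proof. by rewrite pres_lift_class /word_eval big_nil. Qed.

HB.instance Definition _ :=
  isUMagmaMorphism.Build (pres_group rels) G (pres_lift hf) (pres_lift1, pres_liftM).

End PresentedGroupMorphism.

Lemma word_eval_gen (I J : choiceType) (rels : word J -> word J -> Prop)
    (h : I -> J) (w : word I) :
  word_eval (fun i => pres_gen rels (h i)) w
    = pres_class rels [seq (h l.1, l.2) | l <- w].
Proof.
elim: w => [|[i b] w IH]; first by rewrite /word_eval big_nil.
rewrite [LHS]big_cons [X in (_ * X)%g]IH /=.
by case: b; rewrite ?pres_classV pres_classM.
Qed.

(* The group algebra: finitely supported functions on G with the convolution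
   product. monalg only multiplies over monomial monoids, in which no element
   but 1 is invertible, hence the fresh type carrying a new product. *)
Definition grp_alg (k : fieldType) (G : groupType) := {malg k[G]}.

Section GroupAlgebra.
Variables (k : fieldType) (G : groupType).
Local Notation kG := (grp_alg k G).
Implicit Types x y : kG.

HB.instance Definition _ := GRing.Lmodule.on kG.

Definition grp_elt (g : G) : kG := << g >>.

Definition ga_mul x y : kG :=
  \sum_(g <- msupp x) \sum_(h <- msupp y) << x@_g * y@_h *g (g * h)%g >>.

Local Open Scope fset_scope.

Lemma ga_mulw (d1 d2 : {fset G}) x y : msupp x `<=` d1 -> msupp y `<=` d2 ->
  ga_mul x y = \sum_(g <- d1) \sum_(h <- d2) << x@_g * y@_h *g (g * h)%g >>.
Proof.
move=> le1 le2; rewrite /ga_mul (big_fset_incl _ le1) /=.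
  apply/eq_bigr=> g _; apply/big_fset_incl => // h _ /mcoeff_outdom ->.
  by rewrite mulr0 monalgU0.
move=> g _ /mcoeff_outdom xg.
by rewrite big1 => // h _; rewrite xg mul0r monalgU0.
Qed.

Lemma ga_mulDl : left_distributive ga_mul +%R.
Proof.
move=> x y z; rewrite (ga_mulw (msuppD_le x y) (fsubset_refl _)).
rewrite (ga_mulw (fsubsetUl _ (msupp y)) (fsubset_refl _)).
rewrite (ga_mulw (fsubsetUr (msupp x) _) (fsubset_refl _)).
rewrite -big_split /=; apply/eq_bigr=> g _.
rewrite -big_split /=; apply/eq_bigr=> h _.
by rewrite mcoeffD mulrDl monalgUD.
Qed.

Lemma ga_mulDr : right_distributive ga_mul +%R.
Proof.
move=> x y z; rewrite (ga_mulw (fsubset_refl _) (msuppD_le y z)).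
rewrite (ga_mulw (fsubset_refl _) (fsubsetUl _ (msupp z))).
rewrite (ga_mulw (fsubset_refl _) (fsubsetUr (msupp y) _)).
rewrite -big_split /=; apply/eq_bigr=> g _.
rewrite -big_split /=; apply/eq_bigr=> h _.
by rewrite mcoeffD mulrDr monalgUD.
Qed.

Lemma ga_mul0 : left_zero 0 ga_mul.
Proof. by move=> x; rewrite /ga_mul msupp0 big_seq_fset0. Qed.

Lemma ga_mul0r : right_zero 0 ga_mul.
Proof. by move=> x; rewrite /ga_mul big1 // => g _; rewrite msupp0 big_seq_fset0. Qed.

Lemma ga_mulUU (a b : k) (g h : G) :
  ga_mul << a *g g >> << b *g h >> = << a * b *g (g * h)%g >>.
Proof. by rewrite (ga_mulw msuppU_le msuppU_le) !big_seq_fset1 !mcoeffUU. Qed.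

Lemma ga_mul_suml (T : Type) (r : seq T) (F : T -> kG) y :
  ga_mul (\sum_(i <- r) F i) y = \sum_(i <- r) ga_mul (F i) y.
Proof. exact: (big_morph (ga_mul^~ y) (fun _ _ => ga_mulDl _ _ _) (ga_mul0 _)). Qed.

Lemma ga_mul_sumr (T : Type) (r : seq T) (F : T -> kG) x :
  ga_mul x (\sum_(i <- r) F i) = \sum_(i <- r) ga_mul x (F i).
Proof. exact: (big_morph (ga_mul x) (fun _ _ => ga_mulDr _ _ _) (ga_mul0r _)). Qed.

Lemma ga_mulEl x y : ga_mul x y = \sum_(g <- msupp x) ga_mul << x@_g *g g >> y.
Proof. by rewrite -ga_mul_suml -monalgE. Qed.

Lemma ga_mulEr x y : ga_mul x y = \sum_(h <- msupp y) ga_mul x << y@_h *g h >>.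
Proof. by rewrite -ga_mul_sumr -monalgE. Qed.

Lemma ga_mulA : associative ga_mul.
Proof.
move=> x y z; rewrite [LHS]ga_mulEl [ga_mul x y]ga_mulEl ga_mul_suml.
apply/eq_bigr=> g1 _; rewrite [ga_mul y z]ga_mulEl ga_mul_sumr.
rewrite [ga_mul _ y]ga_mulEr ga_mul_suml; apply/eq_bigr=> g2 _.
rewrite [ga_mul _ z]ga_mulEr ga_mul_sumr [RHS]ga_mulEr; apply/eq_bigr=> g3 _.
by rewrite !ga_mulUU mulrA mulgA.
Qed.

Lemma ga_mul1 : left_id (grp_elt 1%g) ga_mul.
Proof.
move=> x; rewrite ga_mulEr [RHS]monalgE; apply/eq_bigr=> g _.
by rewrite ga_mulUU mul1r mul1g.
Qed.

Lemma ga_mul1r : right_id (grp_elt 1%g) ga_mul.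
Proof.
move=> x; rewrite ga_mulEl [RHS]monalgE; apply/eq_bigr=> g _.
by rewrite ga_mulUU mulr1 mulg1.
Qed.

Lemma ga_one_neq0 : grp_elt 1%g != 0.
Proof. by rewrite monalgU_eq0 oner_eq0. Qed.

HB.instance Definition _ := GRing.Zmodule_isNzRing.Build kG
  ga_mulA ga_mul1 ga_mul1r ga_mulDl ga_mulDr ga_one_neq0.

Lemma ga_scalerAl (c : k) x y : c *: (x * y) = (c *: x) * y.
Proof.
have scaleE z : c *: z = (<< c *g 1%g >> : kG) * z.
  rewrite [RHS]ga_mulEr malgZ_def; apply/eq_bigr=> g _.
  by rewrite ga_mulUU mul1g.
by rewrite !scaleE mulrA.
Qed.

HB.instance Definition _ := GRing.Lmodule_isLalgebra.Build k kG ga_scalerAl.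

Lemma ga_scalerAr (c : k) x y : c *: (x * y) = x * (c *: y).
Proof.
have scaleE z : c *: z = z * (<< c *g 1%g >> : kG).
  rewrite [RHS]ga_mulEl malgZ_def; apply/eq_bigr=> g _.
  by rewrite ga_mulUU mulg1 mulrC.
by rewrite !scaleE mulrA.
Qed.

HB.instance Definition _ := GRing.Lalgebra_isAlgebra.Build k kG ga_scalerAr.

Lemma grp_eltM (g h : G) : grp_elt (g * h)%g = grp_elt g * grp_elt h.
Proof. by rewrite [RHS]ga_mulUU mulr1. Qed.

Lemma grp_elt1 : grp_elt 1%g = 1.
Proof. by []. Qed.

Lemma grp_algE x : x = \sum_(g <- msupp x) x@_g *: grp_elt g.
Proof.
rewrite [LHS]monalgE; apply/eq_bigr=> g _.
by apply/malgP=> h; rewrite mcoeffZ !mcoeffU mulrnAr mulr1.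
Qed.

End GroupAlgebra.

Arguments grp_elt k {G} g.

Section TwoSidedIdealQuotient.
Variable R : pzRingType.

Definition two_sided_ideal (J : set R) : Prop :=
  [/\ J 0, forall x y, J x -> J y -> J (x + y),
      forall r x, J x -> J (r * x) & forall r x, J x -> J (x * r)].

Variable A : set R.

Definition ideal_gen : set R := smallest two_sided_ideal A.

Lemma ideal_gen_two_sided : two_sided_ideal ideal_gen.
Proof.
split=> [J [[]]//|x y Jx Jy J JA|r x Jx J JA|r x Jx J JA].
- by case: (JA) => -[_ JD _ _] _; apply: JD; [exact: Jx|exact: Jy].
- by case: (JA) => -[_ _ JM _] _; apply: JM; exact: Jx.
- by case: (JA) => -[_ _ _ JM] _; apply: JM; exact: Jx.
Qed.

Definition ideal_pred : {pred R} := fun x => `[< ideal_gen x >].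

Lemma ideal_predP x : reflect (ideal_gen x) (x \in ideal_pred).
Proof. exact: asboolP. Qed.

Lemma ideal_pred_closed : zmod_closed ideal_pred.
Proof.
have [J0 JD JMl _] := ideal_gen_two_sided.
split=> [|x y /ideal_predP Jx /ideal_predP Jy]; apply/ideal_predP => //.
by apply: JD => //; rewrite -mulN1r; exact: JMl.
Qed.

HB.instance Definition _ := GRing.isZmodClosed.Build R ideal_pred ideal_pred_closed.

(* The quotient of R by the two-sided ideal generated by A. {ideal_quot _}
   only carries a product for proper ideals of commutative rings. *)
Definition ring_quot := {ideal_quot ideal_pred}.

HB.instance Definition _ := GRing.Zmodule.on ring_quot.
HB.instance Definition _ := EqQuotient.on ring_quot.

Definition rq_pi (x : R) : ring_quot := \pi_ring_quot x.

Lemma rq_piP x y : rq_pi x = rq_pi y <-> ideal_gen (x - y).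
Proof.
split=> [/eqmodP|xy]; first by rewrite /= Quotient.equivE => /ideal_predP.
by apply/eqmodP; rewrite /= Quotient.equivE; apply/ideal_predP.
Qed.

Lemma rq_piK (x : ring_quot) : rq_pi (repr x) = x.
Proof. exact: reprK. Qed.

Definition rq_one : ring_quot := rq_pi 1.
Definition rq_mul (x y : ring_quot) : ring_quot := rq_pi (repr x * repr y).

Lemma rq_piD : {morph rq_pi : x y / x + y}.
Proof. by move=> x y; rewrite /rq_pi piE. Qed.

Lemma rq_pi0 : rq_pi 0 = 0.
Proof. by rewrite /rq_pi piE. Qed.

Lemma rq_mulE x y : rq_mul (rq_pi x) (rq_pi y) = rq_pi (x * y).
Proof.
have [_ JD JMl JMr] := ideal_gen_two_sided.
apply/rq_piP; set x' := repr _; set y' := repr _.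
have -> : x' * y' - x * y = (x' - x) * y' + x * (y' - y).
  by rewrite mulrBl mulrBr addrA subrK.
by apply: JD; [apply: JMr|apply: JMl]; apply/rq_piP; rewrite rq_piK.
Qed.

Lemma rq_mulA : associative rq_mul.
Proof.
by move=> x y z; rewrite -[x]rq_piK -[y]rq_piK -[z]rq_piK !rq_mulE mulrA.
Qed.

Lemma rq_mul1 : left_id rq_one rq_mul.
Proof. by move=> x; rewrite -[x]rq_piK rq_mulE mul1r. Qed.

Lemma rq_mul1r : right_id rq_one rq_mul.
Proof. by move=> x; rewrite -[x]rq_piK rq_mulE mulr1. Qed.

Lemma rq_mulDl : left_distributive rq_mul +%R.
Proof.
move=> x y z; rewrite -[x]rq_piK -[y]rq_piK -[z]rq_piK.
by rewrite -rq_piD !rq_mulE -rq_piD mulrDl.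
Qed.

Lemma rq_mulDr : right_distributive rq_mul +%R.
Proof.
move=> x y z; rewrite -[x]rq_piK -[y]rq_piK -[z]rq_piK.
by rewrite -rq_piD !rq_mulE -rq_piD mulrDr.
Qed.

HB.instance Definition _ := GRing.Zmodule_isPzRing.Build ring_quot
  rq_mulA rq_mul1 rq_mul1r rq_mulDl rq_mulDr.

Lemma rq_piM : {morph rq_pi : x y / x * y}.
Proof. by move=> x y; rewrite [RHS]rq_mulE. Qed.

Lemma rq_pi1 : rq_pi 1 = 1.
Proof. by []. Qed.

Lemma rq_pi_eq0 x : rq_pi x = 0 <-> ideal_gen x.
Proof. by rewrite -rq_pi0 rq_piP subr0. Qed.

End TwoSidedIdealQuotient.

(* The generators are indexed from 0: i : 'I_n.-1 stands for s_(i+1). *)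
Inductive gamma_rel (n : nat) : word 'I_n.-1 -> word 'I_n.-1 -> Prop :=
| GammaComm (i j : 'I_n.-1) : (i.+2 <= j)%N || (j.+2 <= i)%N ->
    gamma_rel [:: (i, false); (j, false)] [:: (j, false); (i, false)]
| GammaBraid (i j : 'I_n.-1) : j = i.+1 :> nat ->
    gamma_rel [:: (i, false); (j, false); (i, false)]
              [:: (j, false); (i, false); (j, false)]
| GammaCube (i : 'I_n.-1) :
    gamma_rel [:: (i, false); (i, false); (i, false)] [::].

Definition Gamma (n : nat) := pres_group (@gamma_rel n).
HB.instance Definition _ n := Group.on (Gamma n).

Definition gamma_gen n (i : 'I_n.-1) : Gamma n := pres_gen (@gamma_rel n) i.

Lemma gamma_cube n (i : 'I_n.-1) :
  (gamma_gen i * gamma_gen i * gamma_gen i = 1 :> Gamma n)%g.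
Proof.
rewrite /gamma_gen /pres_gen !pres_class3; apply/pres_classP.
by apply: PresRel; exact: GammaCube.
Qed.

Lemma gamma_comm n (i j : 'I_n.-1) : (i.+2 <= j)%N || (j.+2 <= i)%N ->
  (gamma_gen i * gamma_gen j = gamma_gen j * gamma_gen i :> Gamma n)%g.
Proof.
move=> ij; rewrite /gamma_gen /pres_gen !pres_classM; apply/pres_classP.
by apply: PresRel; exact: GammaComm.
Qed.

Lemma gamma_braid n (i j : 'I_n.-1) : j = i.+1 :> nat ->
  (gamma_gen i * gamma_gen j * gamma_gen i
     = gamma_gen j * gamma_gen i * gamma_gen j :> Gamma n)%g.
Proof.
move=> ij; rewrite /gamma_gen /pres_gen !pres_class3; apply/pres_classP.
by apply: PresRel; exact: GammaBraid.
Qed.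

Lemma Gamma_degree_respects : respects (@gamma_rel 3) (fun=> (1%R : 'Z_3)).
Proof.
move=> u v [i j _|i j _|i]; rewrite /word_eval !big_cons !big_nil //=.
by apply/val_inj.
Qed.

(* The group law of 'Z_3 is its addition, so this is the morphism from Gamma 3
   to the cyclic group of order 3 sending both generators to its generator 1. *)
Definition Gamma_degree : Gamma 3 -> 'Z_3 := pres_lift Gamma_degree_respects.
HB.instance Definition _ := UMagmaMorphism.on Gamma_degree.

Lemma Gamma_degree_gen i : Gamma_degree (gamma_gen i) = 1%R.
Proof. exact: pres_lift_gen. Qed.

Definition Q : set (Gamma 3) := [set g | Gamma_degree g = 1%g].

Section QuaternionNormalForm.
Local Open Scope group_scope.
Variables (G : groupType) (a b x y w : G).
Hypotheses (a3 : a * a * a = 1) (b3 : b * b * b = 1).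
Hypothesis braid : a * b * a = b * a * b.

Hypotheses (xD : x = a * b^-1) (yD : y = a * x * a^-1) (wD : w = b^-1 * a).

Let ainv : a^-1 = a * a. Proof. by apply: (mulgI a); rewrite mulgV !mulgA a3. Qed.
Let conj_y : a * y * a^-1 = w.
Proof. by rewrite yD wD xD !mulgA a3 mul1g -!mulgA -invgM -ainv invgK. Qed.
Let conj_w : a * w * a^-1 = x.
Proof. by rewrite wD xD !mulgA mulgK. Qed.

Let conjD u v : a * (u * v^-1) * a^-1 = (a * u * a^-1) * (a * v * a^-1)^-1.
Proof. by rewrite !invgM invgK !mulgA mulgVK. Qed.

Let yE : y = x * w^-1.
Proof.
have cj : a * b * a^-1 = b^-1 * a * b.
  by apply: (mulgI b); apply: (mulIg a); rewrite !mulgA mulgVK mulgV mul1g braid.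
rewrite yD wD xD invgM invgK -!mulgA; congr (a * _).
by apply: invg_inj; rewrite !invgM !invgK.
Qed.
Let wE : w = y * x^-1.
Proof. by rewrite -conj_y {1}yE conjD conj_w -yD. Qed.
Let xE : x = w * y^-1.
Proof. by rewrite -conj_w {1}wE conjD conj_y -yD. Qed.

Let y2 : y * y = x * x.
Proof. by rewrite {1}yE wE invgM invgK !mulgA mulgVK. Qed.
Let xyx : x * y * x = y.
Proof. by rewrite {1}xE mulgVK wE mulgVK. Qed.
Let x4 : x * x * x * x = 1.
Proof.
have e : y * (x * x) = (x * x) * y by rewrite -y2 mulgA.
have e' : x * x * y * (x * x) = y.
  by transitivity (x * (x * y * x) * x); [rewrite !mulgA|rewrite !xyx].
by apply: (mulIg y); rewrite mul1g -[RHS]e' -[RHS]mulgA e !mulgA.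
Qed.
Let xinv : x^-1 = x ^+ 3.
Proof. by apply: (mulgI x); rewrite mulgV !expgS expg0 mulg1 !mulgA x4. Qed.
Let xy : x * y = y * x ^+ 3.
Proof. by rewrite -xinv -{2}xyx mulgK. Qed.

Let H (h : G) := exists (j : bool) (i : nat), h = y ^+ j * x ^+ i.

Let Hx h : H h -> H (x * h).
Proof.
move=> [[] [i ->]]; rewrite ?expg1 ?expg0.
  by exists true, (3 + i); rewrite expg1 mulgA xy -mulgA expgnDr.
by exists false, i.+1; rewrite !expg0 !mul1g expgS.
Qed.
Let Hy h : H h -> H (y * h).
Proof.
move=> [[] [i ->]]; rewrite ?expg1 ?expg0.
  by exists false, i.+2; rewrite expg0 mul1g mulgA y2 !expgS mulgA.
by exists true, i; rewrite mul1g.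
Qed.
Let Hw h : H h -> H (w * h).
Proof. by move=> Hh; rewrite wE xinv !expgS expg0 mulg1 -!mulgA; do !apply: Hy || apply: Hx. Qed.

Let Hconj h : H h -> H (a * h * a^-1).
Proof.
have conjM u v : a * (u * v) * a^-1 = (a * u * a^-1) * (a * v * a^-1).
  by rewrite !mulgA mulgVK.
have H1 : H 1 by exists false, 0; rewrite !expg0 mulg1.
move=> [j [i ->]]; rewrite conjM.
have Hxi : H (a * x ^+ i * a^-1).
  elim: i => [|i IH]; first by rewrite expg0 mulg1 mulgV.
  by rewrite expgS conjM -yD; exact: Hy.
case: j; first by rewrite expg1 conj_y; exact: Hw.
by rewrite expg0 mulg1 mulgV mul1g.
Qed.

Let S (g : G) := exists (h : G) (e : nat), H h /\ g = h * a ^+ e.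

Let Sa g : S g -> S (a * g).
Proof.
move=> [h [e [Hh ->]]]; exists (a * h * a^-1), e.+1.
by split; [exact: Hconj|rewrite expgS !mulgA mulgVK].
Qed.
Let Sb g : S g -> S (b * g).
Proof.
have -> : b = x * x * x * a.
  have <- : x^-1 = x * x * x by rewrite xinv !expgS expg0 mulg1 mulgA.
  by rewrite xD invgM invgK mulgVK.
move=> /Sa; rewrite -mulgA; move: (a * g) => {}g [h [e [Hh ->]]].
exists (x * x * x * h), e; rewrite !mulgA; split => //.
by rewrite -!mulgA; do 3!apply: Hx.
Qed.

Lemma quaternion_normal_form (bs : seq (bool * bool)) :
  exists t : bool * 'I_4 * 'I_3,
    \prod_(l <- bs) (if l.2 then (if l.1 then b else a)^-1 else if l.1 then b else a)
    = y ^+ t.1.1 * x ^+ t.1.2 * a ^+ t.2.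
Proof.
suff [h [e [[j [i ->]] ->]]] : S (\prod_(l <- bs)
    (if l.2 then (if l.1 then b else a)^-1 else if l.1 then b else a)).
  exists (j, inord (i %% 4), inord (e %% 3)) => /=.
  rewrite !inordK ?ltn_mod // {1}(divn_eq i 4) {1}(divn_eq e 3).
  rewrite !expgnDr ![(_ * 4)%N]mulnC ![(_ * 3)%N]mulnC !expgnA.
  have -> : x ^+ 4 = 1 by rewrite !expgS expg0 mulg1 !mulgA x4.
  have -> : a ^+ 3 = 1 by rewrite !expgS expg0 mulg1 !mulgA a3.
  by rewrite !expg1n !mul1g.
have binv : b^-1 = b * b by apply: (mulgI b); rewrite mulgV !mulgA b3.
elim: bs => [|[[] []] bs IH]; rewrite ?big_nil ?big_cons /=.
- exists 1, 0; split; last by rewrite expg0 mulg1.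
  by exists false, 0; rewrite !expg0 mulg1.
- by rewrite binv -mulgA; do 2!apply: Sb.
- exact: Sb.
- by rewrite ainv -mulgA; do 2!apply: Sa.
- exact: Sa.
Qed.

End QuaternionNormalForm.

Lemma finite_Gamma3 : finite_set [set: Gamma 3].
Proof.
pose a : Gamma 3 := gamma_gen (ord0 : 'I_3.-1).
pose b : Gamma 3 := gamma_gen (ord_max : 'I_3.-1).
have nf := @quaternion_normal_form _ a b _ _ _ (gamma_cube _) (gamma_cube _)
  (@gamma_braid 3 ord0 ord_max erefl) erefl erefl erefl.
pose x := (a * b^-1)%g.
pose F (t : bool * 'I_4 * 'I_3) :=
  ((a * x * a^-1) ^+ t.1.1 * x ^+ t.1.2 * a ^+ t.2)%g.
apply: (@sub_finite_set _ _ (F @` [set: bool * 'I_4 * 'I_3])); last first.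
  exact/finite_image/finite_finset.
move=> g _; rewrite -[g]pres_classK; move: (repr g) => wd.
have [t tE] := nf [seq (l.1 == ord_max, l.2) | l <- wd].
exists t => //; rewrite /F -tE big_map.
have -> : pres_class (@gamma_rel 3) wd = word_eval (@gamma_gen 3) wd.
  by rewrite (word_eval_gen _ id) map_id_in // => -[].
apply: eq_bigr => -[i c] _ /=.
have -> : @gamma_gen 3 i = if i == ord_max then b else a.
  by case: eqP => [->//|/eqP ne]; congr gamma_gen; apply: val_inj;
     case: i ne => -[|[|//]].
by [].
Qed.

Lemma finite_Q : finite_set Q.
Proof. exact: sub_finite_set finite_Gamma3. Qed.

Lemma gamma_idx_le n (hn : (3 <= n)%N) : (3.-1 <= n.-1)%N.
Proof. by rewrite -!subn1 leq_sub2r. Qed.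

Definition gamma_idx n (hn : (3 <= n)%N) : 'I_3.-1 -> 'I_n.-1 :=
  widen_ord (gamma_idx_le hn).

Lemma Gamma_nat_respects n (hn : (3 <= n)%N) :
  respects (@gamma_rel 3) (fun i => gamma_gen (gamma_idx hn i)).
Proof.
move=> u v uv; rewrite !word_eval_gen; apply/pres_classP; apply: PresRel.
by case: uv => [i j ij|i j ij|i]; constructor.
Qed.

Definition Gamma_nat n (hn : (3 <= n)%N) : Gamma 3 -> Gamma n :=
  pres_lift (Gamma_nat_respects hn).
HB.instance Definition _ n hn := UMagmaMorphism.on (@Gamma_nat n hn).

Lemma Gamma_nat_gen n (hn : (3 <= n)%N) i :
  Gamma_nat hn (gamma_gen i) = gamma_gen (gamma_idx hn i).
Proof. exact: pres_lift_gen. Qed.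

(* A finitely supported sum over a set; it is 0 for an infinite support, which
   finite_Q excludes. *)
Definition q_elt (k : fieldType) n (hn : (3 <= n)%N) : grp_alg k (Gamma n) :=
  \sum_(g \in Q) grp_elt k (Gamma_nat hn g).

Definition kK (k : fieldType) n (hn : (3 <= n)%N) :=
  ring_quot [set q_elt k hn].
HB.instance Definition _ k n hn := GRing.PzRing.on (@kK k n hn).

(* Main.v *)
(* In Gamma_5 the conjugates of s_1 are indexed by the 40 lines of F_3^4 and conjugate
   each other as the transvections of Sp_4(3); modulo a central element they form a
   family T_v with T_u T_v T_(u+v) T_(u-v) = 1 for the lines of an isotropic plane
   <u, v>. Let N_v = 1 + T_v + T_v^2. The quaternion group of
   a hyperbolic plane acts without fixed points on the radical, extraspecial of centre
   T_v, of the stabiliser of a line v orthogonal to the plane; averaging the relation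
   q = 0 over the radical shows that N_v absorbs it. Hence F = N_v N_w depends only on
   the isotropic plane <v, w>, and the central involutions z of the quaternion groups
   multiply F in few ways. Computing F x F for suitable x by means of
   N_s N_t N_s = N_s (2 - z), which also follows from q = 0, gives 8 F (5 - 4 z) = 0
   for an involution z commuting with F, so F = 0 as (5 - 4 z)(5 + 4 z) = 9. Then all
   the involutions z are equal to -1, and conjugation by them identifies commuting
   transvections; by the braid relations all T_v equal 1, so 0 = F = 9. *)

(* All that the collapse takes from the group is recorded in the four clauses of [system]. These
   clauses survive composition with transvections, so an identity proved for [e1], [f1], [e2], [f2]
   holds on its whole orbit under Sp_4(3), at the price of one word per transport. The obstacle is
   to produce the family T_v in a group given by generators and relations, where equalities cannot
   be computed: a certificate in the style of coset enumeration supplies the deductions, and only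
   its verification is a computation. The isotropic plane behind F lies obliquely to two orthogonal
   hyperbolic planes: each of its lines is orthogonal to exactly one line of <e1, f1>, so that in F
   N_p F, for p in <e1, f1>, one factor of F can be made to commute with N_p while the other
   sandwiches it. The only integers cancelled are products of 2 and 3, which is where the
   characteristic enters. *)
Require Import Defs.
From HB Require Import structures.
From mathcomp Require Import all_boot all_order all_algebra all_fingroup.
From mathcomp Require Import generic_quotient boolp classical_sets fsbigop.

Set Implicit Arguments.
Unset Strict Implicit.
Unset Printing Implicit Defensive.

Import GRing.Theory.
Local Open Scope ring_scope.

(** * Words in two braid generators of order three *)

(* The central involution of the quaternion group of <s, t>. *)
HB.lock Definition quat_center (G : groupType) (s t : G) : G := ((s * t) ^+ 3)%g.

Section TernaryBraid.
Local Open Scope group_scope.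
Variables (G : groupType) (s t : G).
Hypotheses (s3 : s ^+ 3 = 1) (t3 : t ^+ 3 = 1) (st : s * t * s = t * s * t).

Lemma cube_inv (g : G) : g ^+ 3 = 1 -> g^-1 = g * g.
Proof. by move=> g3; apply: (mulgI g); rewrite mulgV -g3 !expgS expg0 mulg1. Qed.

Let zE : quat_center s t = s * t * s * (s * t * s).
Proof. by rewrite quat_center.unlock !expgS expg0 mulg1 {2}st !mulgA. Qed.

Let ws : s * t * s * s = t * (s * t * s). Proof. by rewrite {1}st !mulgA. Qed.
Let wt : s * t * s * t = s * (s * t * s). Proof. by rewrite -2!mulgA [t * _]mulgA -st !mulgA. Qed.

Lemma quat_centerCs : commute (quat_center s t) s.
Proof. by rewrite /commute zE -mulgA ws mulgA wt !mulgA. Qed.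

Lemma quat_centerCt : commute (quat_center s t) t.
Proof. by rewrite /commute zE -mulgA wt mulgA ws !mulgA. Qed.

Let conj_st : s * t * s^-1 = t^-1 * s * t.
Proof. by apply: (mulgI t); apply: (mulIg s); rewrite !mulgA mulgVK mulgV mul1g st. Qed.

Lemma quat_centerE : quat_center s t = t^-1 * s * t^-1 * s.
Proof.
have t2 := cube_inv t3; have s2 := cube_inv s3.
rewrite zE !mulgA -[_ * s * s]mulgA -s2 conj_st -[_ * t * t]mulgA -t2.
by [].
Qed.
End TernaryBraid.

Section TernaryBraid2.
Local Open Scope group_scope.
Variables (G : groupType) (s t : G).
Hypotheses (s3 : s ^+ 3 = 1) (t3 : t ^+ 3 = 1) (st : s * t * s = t * s * t).

Lemma quat_centerC : quat_center t s = quat_center s t.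
Proof.
rewrite quat_center.unlock !expgS expg0 !mulg1.
have -> : t * s * (t * s * (t * s)) = (t * s * t) * (s * t * s) by rewrite !mulgA.
have -> : s * t * (s * t * (s * t)) = (s * t * s) * (t * s * t) by rewrite !mulgA.
by rewrite st.
Qed.

(** The inverse of the word [t^-1 * s * t^-1 * s] is the same word with [s] and [t] exchanged. *)
Lemma quat_centerV : (quat_center s t)^-1 = quat_center s t.
Proof.
rewrite -{2}quat_centerC (quat_centerE s3 t3 st) (quat_centerE t3 s3 (esym st)).
have c : commute (quat_center s t) s := quat_centerCs st.
rewrite !invgM !invgK.
have e : s^-1 * t * (s^-1 * t) = t * (s^-1 * t * s^-1 * t) * t^-1.
  have := quat_centerCt (esym st); have := quat_centerCs (esym st).
  rewrite (quat_centerE t3 s3 (esym st)) => ct _.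
  by rewrite -[t * _]ct mulgK !mulgA.
by rewrite -!mulgA.
Qed.

Lemma quat_center2 : quat_center s t * quat_center s t = 1.
Proof. by rewrite -{1}quat_centerV mulVg. Qed.

Lemma quat_centerXX : s * t^-1 * s * t^-1 = quat_center s t.
Proof.
have := quat_centerCt st; rewrite /commute (quat_centerE s3 t3 st) => ct.
by apply: (mulIg t); rewrite ct !mulgA mulgVK mulgV mul1g.
Qed.
End TernaryBraid2.

(** * Representations annihilating the quaternion sum *)

(** For [g] of order 3 and 3 invertible, three times the projector onto the invariants of [g]. *)
HB.lock Definition cyc_sum (G : groupType) (R : pzRingType) (rho : G -> R) (g : G) : R :=
  1 + rho g + rho (g * g)%g.

Section Representation.
Variables (G : groupType) (R : pzRingType) (rho : G -> R).
Hypotheses (rho1 : rho 1%g = 1) (rhoM : {morph rho : x y / (x * y)%g >-> x * y}).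

Local Notation cyc_sum := (cyc_sum rho).

(* The quaternion group is {1, z} * {1, X, Y, W} with X = s t^-1, Y = s X s^-1,
   W = t^-1 s and z its central involution. *)
Definition quat_sum (s t : G) : R := (1 + rho (quat_center s t)) *
  (1 + rho (s * t^-1)%g + rho (s * (s * t^-1) * s^-1)%g + rho (t^-1 * s)%g).

Lemma rhoC (g h : G) : commute g h -> GRing.comm (rho g) (rho h).
Proof. by move=> gh; rewrite /GRing.comm -!rhoM gh. Qed.

Lemma rhoVK (g : G) : rho g^-1%g * rho g = 1. Proof. by rewrite -rhoM mulVg. Qed.
Lemma rhoKV (g : G) : rho g * rho g^-1%g = 1. Proof. by rewrite -rhoM mulgV. Qed.

Lemma cyc_sumE (g : G) : cyc_sum g = 1 + rho g + rho g * rho g.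
Proof. by rewrite cyc_sum.unlock rhoM. Qed.

Lemma cyc_sum_comm (g : G) (x : R) : GRing.comm x (rho g) -> GRing.comm x (cyc_sum g).
Proof.
move=> c; rewrite cyc_sumE; do 2?apply: commrD; first exact: commr1.
  exact: c.
exact: commrM.
Qed.

Lemma cyc_sumC (g h : G) : commute g h -> GRing.comm (cyc_sum g) (cyc_sum h).
Proof. by move=> gh; apply/cyc_sum_comm/commr_sym/cyc_sum_comm/rhoC/commute_sym. Qed.

Lemma cyc_sumJ (g h : G) :
  cyc_sum (h * g * h^-1)%g = rho h * cyc_sum g * rho h^-1%g.
Proof.
rewrite !cyc_sumE !mulrDr !mulrDl mulr1 rhoKV !rhoM.
by rewrite -!mulrA [rho h^-1%g * _]mulrA rhoVK mul1r !mulrA.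
Qed.

Section CyclicOfOrder3.
Variable g : G.
Hypothesis g3 : (g ^+ 3 = 1)%g.

Let gg : rho (g * g)%g * rho g = 1.
Proof. by rewrite -rhoM -rho1 -g3 !expgS expg0 mulg1 mulgA. Qed.

Lemma cyc_sumMl : cyc_sum g * rho g = cyc_sum g.
Proof.
rewrite cyc_sum.unlock !mulrDl gg mul1r -rhoM.
by rewrite addrC addrA.
Qed.

Lemma cyc_sumMr : rho g * cyc_sum g = cyc_sum g.
Proof. by rewrite (cyc_sum_comm (erefl : GRing.comm (rho g) _)) cyc_sumMl. Qed.

Lemma cyc_sum_sq : cyc_sum g * cyc_sum g = cyc_sum g *+ 3.
Proof.
by rewrite {2}cyc_sumE !mulrDr mulr1 mulrA !cyc_sumMl !mulrS mulr0n addr0 addrA.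
Qed.

End CyclicOfOrder3.

(** * The quaternion relation for one braid pair *)

Section TernaryBraidPair.
Variables (s t : G).
Hypotheses (s3 : (s ^+ 3 = 1)%g) (t3 : (t ^+ 3 = 1)%g).
Hypothesis st : (s * t * s = t * s * t)%g.
Hypothesis qst : quat_sum s t = 0.
Hypothesis reg2 : injective (fun x : R => x *+ 2).
Hypothesis reg3 : injective (fun x : R => x *+ 3).
Local Notation z := (quat_center s t).
Local Notation N := cyc_sum.

Lemma quat_centerK : rho z * rho z = 1.
Proof. by rewrite -rhoM (quat_center2 s3 t3 st). Qed.

Lemma quat_centerD1 : (1 + rho z) * rho z = 1 + rho z.
Proof. by rewrite mulrDl mul1r quat_centerK addrC. Qed.

Let zs : GRing.comm (rho z) (rho s). Proof. exact/rhoC/quat_centerCs. Qed.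
Let zt : GRing.comm (rho z) (rho t). Proof. exact/rhoC/quat_centerCt. Qed.

Let absorb (g h : G) : g = (z * h)%g -> (1 + rho z) * rho g = (1 + rho z) * rho h.
Proof. by move->; rewrite rhoM mulrA quat_centerD1. Qed.

Let X := (s * t^-1)%g.
Let Y := (s * (s * t^-1) * s^-1)%g.
Let W := (t^-1 * s)%g.

Let Xz : (X * X = z)%g. Proof. by rewrite -(quat_centerXX s3 t3 st) !mulgA. Qed.
Let sinv : (s^-1 = s * s)%g. Proof. exact: cube_inv. Qed.
Let tinv : (t^-1 = t * t)%g. Proof. exact: cube_inv. Qed.
Let zz : (z * z = 1)%g. Proof. exact: quat_center2. Qed.

Let invz (g : G) : (g * g = z)%g -> (g = z * g^-1)%g.
Proof. by move=> <-; rewrite mulgK. Qed.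

Let q0 : (1 + rho z) * (1 + rho X + rho Y + rho W) = 0. Proof. exact: qst. Qed.

Let q1 : (1 + rho z) * (rho s + rho t + rho (s * t * s^-1)%g + rho (s^-1 * t * s)%g) = 0.
Proof.
have zc : commute z s := quat_centerCs st.
have Yz : (Y * Y = z)%g.
  have -> : (Y * Y = s * (X * X) * s^-1)%g by rewrite /Y /X !mulgA mulgVK.
  by rewrite Xz -zc mulgK.
have Wz : (W * W = z)%g by rewrite (quat_centerE s3 t3 st) /W !mulgA.
have <- : (1 + rho z) * (1 + rho X + rho Y + rho W) * rho s =
   (1 + rho z) * (rho s + rho t + rho (s * t * s^-1)%g + rho (s^-1 * t * s)%g); last first.
  by rewrite q0 mul0r.
move: (1 + rho z) absorb => a absorb_a.
rewrite -mulrA !mulrDl mul1r -!rhoM !(mulrDr a).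
congr (_ + _ + _ + _); apply: absorb_a.
- by rewrite {1}(invz Xz) /X invgM invgK -!mulgA mulVg mulg1.
- by rewrite {1}(invz Yz) /Y !invgM !invgK !mulgA mulgVK.
- by rewrite {1}(invz Wz) /W invgM invgK !mulgA.
Qed.

Let q2 : (1 + rho z) * (rho (s * s)%g + rho (t * t)%g
   + rho (s * t * s^-1 * (s * t * s^-1))%g + rho (s^-1 * t * s * (s^-1 * t * s))%g) = 0.
Proof.
have <- : rho s^-1%g * ((1 + rho z) * (1 + rho X + rho Y + rho W)) =
  (1 + rho z) * (rho (s * s)%g + rho (t * t)%g
   + rho (s * t * s^-1 * (s * t * s^-1))%g + rho (s^-1 * t * s * (s^-1 * t * s))%g);
  last by rewrite q0 mulr0.
rewrite mulrA.
have -> : rho s^-1%g * (1 + rho z) = (1 + rho z) * rho s^-1%g.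
  by rewrite mulrDl mulrDr mulr1 mul1r sinv rhoM (commrM zs zs).
rewrite -mulrA; congr (_ * _); rewrite !mulrDr mulr1 -!rhoM.
congr (rho _ + rho _ + rho _ + rho _).
- by [].
- by rewrite /X mulgA mulVg mul1g tinv.
- by rewrite /Y !mulgA mulVg mul1g mulgVK -[(s * t * t)%g]mulgA -tinv.
- by rewrite /W tinv !mulgA mulgK.
Qed.

(** Modulo [z], the coset [Q s] consists of the four conjugates of [s] in <s, t>, and [s^-1 Q] of
    their squares. The quaternion sum being 0, both cosets drop out of the sum of the four [N]
    ([q1], [q2]) and only the four units remain. *)
Lemma sum_lines : (1 + rho z) * (N s + N t + N (s * t * s^-1)%g + N (s^-1 * t * s)%g)
  = (1 + rho z) *+ 4.
Proof.
have -> : N s + N t + N (s * t * s^-1)%g + N (s^-1 * t * s)%g =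
   1 *+ 4 + (rho s + rho t + rho (s * t * s^-1)%g + rho (s^-1 * t * s)%g) +
   (rho (s * s)%g + rho (t * t)%g
   + rho (s * t * s^-1 * (s * t * s^-1))%g + rho (s^-1 * t * s * (s^-1 * t * s))%g).
  rewrite cyc_sum.unlock !mulrS mulr0n addr0.
  by rewrite [LHS](AC ((3*3)*3*3) ((1*(4*(7*10)))*(2*5*8*11)*(3*6*9*12))).
by rewrite 2!mulrDr q1 q2 !addr0 mulr_natr.
Qed.

Let zN : GRing.comm (rho z) (N s). Proof. exact: cyc_sum_comm zs. Qed.
Let z1N : (1 + rho z) * N s = N s * (1 + rho z).
Proof. by rewrite mulrDl mul1r (mulrDr (N s)) mulr1 zN. Qed.

(** One has [t^-1 = z * s^-1 * t * s^-1], and [N s] absorbs the powers of [s]. *)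
Let NtV : N s * rho (t * t)%g * N s = rho z * (N s * rho t * N s).
Proof.
have ww : (s * t * s * (s * t * s) = z)%g.
  by rewrite {2}st quat_center.unlock !expgS expg0 mulg1 !mulgA.
have e : (t * t = z * (s * s * t * s * s))%g.
  rewrite -tinv; apply: (mulIg t); rewrite mulVg.
  have -> : (z * (s * s * t * s * s) * t = z * (s * (s * t * s * (s * t * s)) * s^-1))%g.
    by rewrite !mulgA mulgK.
  by rewrite ww -(quat_centerCs st) mulgK zz.
have NNs (x : R) : N s * (rho s * x) = N s * x by rewrite mulrA cyc_sumMl.
have zNx (x : R) : N s * (rho z * x) = rho z * (N s * x) by rewrite !mulrA zN.
by rewrite e !rhoM -!mulrA !(cyc_sumMr s3) zNx !NNs.
Qed.

(** By [NtV] the product is 3 N_s + (1 + z) a. Placing [sum_lines] between two factors N_s makes the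
    three conjugates of [t] contribute equally, which gives (1 + z) N_s N_t N_s = (1 + z) N_s; as (1
    + z)^2 = 2 (1 + z), this determines (1 + z) a = - (1 + z) N_s. *)
Lemma cyc_sum_sandwich : N s * N t * N s = N s * (2 - rho z).
Proof.
set a := N s * rho t * N s.
have NtN : N s * N t * N s = N s *+ 3 + (1 + rho z) * a.
  rewrite {2}cyc_sum.unlock !(mulrDr (N s)) mulr1 !mulrDl (cyc_sum_sq s3) NtV.
  by rewrite mul1r addrA.
have NJ (g : G) : N s * N (g * t * g^-1)%g * N s = N s * (rho g * N t * rho g^-1%g) * N s.
  by rewrite cyc_sumJ.
have Ns1 : N s * rho s^-1%g = N s by rewrite sinv rhoM mulrA !cyc_sumMl.
have Ns2 : rho s^-1%g * N s = N s by rewrite sinv rhoM -mulrA !cyc_sumMr.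
have H1 : (1 + rho z) * (N s * N t * N s) = (1 + rho z) * N s.
  have e1 : N s * N (s * t * s^-1)%g * N s = N s * N t * N s.
    by rewrite NJ !mulrA cyc_sumMl // -[_ * rho s^-1%g * _]mulrA Ns2.
  have e2 : N s * N (s^-1 * t * s)%g * N s = N s * N t * N s.
    by have := NJ s^-1%g; rewrite invgK => ->; rewrite !mulrA Ns1 -[_ * rho s * _]mulrA cyc_sumMr.
  have eS : N s * ((N s + N t + N (s * t * s^-1)%g + N (s^-1 * t * s)%g) * N s)
      = N s *+ 9 + N s * N t * N s *+ 3.
    rewrite !mulrDl !mulrDr !mulrA e1 e2 -mulrA (cyc_sum_sq s3) mulrnAr (cyc_sum_sq s3) -mulrnA.
    by rewrite (mulrS (N s * N t * N s) 2) mulr2n !addrA.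
  have eR : N s * ((1 + rho z) *+ 4 * N s) = (1 + rho z) * N s *+ 12.
    by rewrite mulrnAl mulrnAr z1N mulrA (cyc_sum_sq s3) mulrnAl -mulrnA -z1N.
  have := congr1 (fun x => N s * x * N s) sum_lines.
  rewrite -!mulrA eR mulrA -z1N -mulrA eS mulrDr !mulrnAr -[12%N]/(9 + 3)%N (mulrnDr _ 9 3).
  by move/addrI/reg3; rewrite !mulrA.
have H2 : (1 + rho z) * a = - ((1 + rho z) * N s).
  have PP : (1 + rho z) * (1 + rho z) = (1 + rho z) *+ 2.
    by rewrite mulrDr mulr1 quat_centerD1 mulr2n.
  apply/reg2/(addrI ((1 + rho z) * N s *+ 3)).
  by rewrite /= mulNrn -mulrnBr // -{}[RHS]H1 NtN mulrDr mulrA PP mulrnAr mulrnAl.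
rewrite NtN H2 z1N -(mulr_natr (N s) 3) -mulrN -mulrDr; congr (_ * _).
by rewrite opprD addrA -[3%N]/(2 + 1)%N natrD addrK.
Qed.

End TernaryBraidPair.

(* <x, y> is extraspecial of order 27 with centre zeta, and the quaternion group
   <s, t>' acts on <x, y>/<zeta> = F_3^2, freely away from 0. Summing the
   conjugates of g over the vectors v of F_3^2, modulo zeta, gives 9 for g = 1 and
   (sum of the v) * g for the other g; applied to the vanishing quaternion sum
   this yields 9 * N = sum over <x, y>, which x leaves unchanged. *)
Section FrobeniusAction.
Variables (zeta x y s t : G).
Hypotheses (zeta3 : (zeta ^+ 3 = 1)%g) (x3 : (x ^+ 3 = 1)%g) (y3 : (y ^+ 3 = 1)%g).
Hypotheses (s3 : (s ^+ 3 = 1)%g) (t3 : (t ^+ 3 = 1)%g).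
Hypotheses (zx : commute zeta x) (zy : commute zeta y).
Hypotheses (zs : commute zeta s) (zt : commute zeta t).
Hypothesis yx : (y * x * zeta = x * y)%g.
Hypotheses (sx : commute s x) (sy : (x * s * y = y * s)%g).
Hypotheses (tx : (t * x = x * y * t)%g) (ty : commute t y).
Hypothesis qst : quat_sum s t = 0.
Hypothesis reg3 : injective (fun x : R => x *+ 3).
Local Notation N := (cyc_sum zeta).

(* Equality modulo zeta, as seen after multiplication by N. *)
Let eqN (g h : G) := N * rho g = N * rho h.

Let eqN_sym g h : eqN g h -> eqN h g. Proof. exact: esym. Qed.
Let eqN_trans g h k : eqN g h -> eqN h k -> eqN g k. Proof. exact: etrans. Qed.

Let eqNM g g' h h' : commute zeta g -> eqN g g' -> eqN h h' -> eqN (g * h)%g (g' * h')%g.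
Proof.
move=> /rhoC/commr_sym/cyc_sum_comm c eg eh; rewrite /eqN !rhoM mulrA -c -mulrA eh.
by rewrite mulrA c eg mulrA.
Qed.

Let eqN_mull g h h' : commute zeta g -> eqN h h' -> eqN (g * h)%g (g * h')%g.
Proof. by move=> zg; exact: (@eqNM g g). Qed.

Let eqN_mulr g g' h : commute zeta g -> eqN g g' -> eqN (g * h)%g (g' * h)%g.
Proof. by move=> zg eg; exact: eqNM. Qed.

Let eqNz g : commute zeta g -> eqN (g * zeta)%g g.
Proof. by move=> zg; rewrite /eqN -zg rhoM mulrA (cyc_sumMl zeta3). Qed.

(** Exponents are natural numbers, with 2 in the role of -1: [m (2 * i, 2 * j)] inverts [m (i, j)]
    modulo [zeta]. *)
Let m (v : nat * nat) := (x ^+ v.1 * y ^+ v.2)%g.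

Let zm v : commute zeta (m v).
Proof. by apply: commuteM; apply: commuteX. Qed.

Let eqNX g h i : commute zeta g -> commute zeta h ->
  eqN (g * h)%g (h * g)%g -> eqN (g * h ^+ i)%g (h ^+ i * g)%g.
Proof.
move=> zg zh gh; elim: i => [|i IH]; first by rewrite expg0 mulg1 mul1g.
rewrite !expgS mulgA; apply: eqN_trans (eqN_mulr _ _ gh) _; first exact: commuteM.
by rewrite -!mulgA; apply: eqNM.
Qed.

Let yxi i j : eqN (y ^+ j * x ^+ i)%g (m (i, j)).
Proof.
apply/eqN_sym/eqNX => //; first exact: commuteX.
apply/eqN_sym/eqNX => //.
by rewrite -yx; apply/eqN_sym/eqNz/commuteM.
Qed.

Let mD u v : eqN (m u * m v)%g (m (u.1 + v.1, u.2 + v.2)%N).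
Proof.
rewrite /m -!mulgA !expgnDr -!mulgA.
apply: eqNM; [exact: commuteX|by []|].
rewrite ![(_ * (_ * _))%g]mulgA; apply: eqNM; [|exact: yxi|by []].
by apply: commuteM; apply: commuteX.
Qed.

Let m_mod i j : m (i %% 3, j %% 3)%N = m (i, j).
Proof.
have modX (g : G) k : (g ^+ 3 = 1 -> g ^+ (k %% 3) = g ^+ k)%g.
  by move=> g3; rewrite {2}(divn_eq k 3) mulnC expgnDr expgnA g3 expg1n mul1g.
by rewrite /m /= !modX.
Qed.

Let acts g (M : nat * nat -> nat * nat) :=
  commute zeta g /\ forall v, eqN (g * m v)%g (m (M v) * g)%g.

Let acts_s : acts s (fun v => (v.1 + 2 * v.2, v.2)%N).
Proof.
split=> // -[i j]; rewrite /m /=.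
have -> : (s * (x ^+ i * y ^+ j) = m (i, 0%N) * (s * y ^+ j))%g.
  by rewrite /m expg0 mulg1 !mulgA (commuteX i sx).
have sj : eqN (s * y ^+ j)%g (m (2 * j, j)%N * s)%g.
  elim: j => [|j IH]; first by rewrite /m !expg0 !mulg1 mul1g.
  have -> : (s * y ^+ j.+1 = m (2%N, 1%N) * (s * y ^+ j))%g.
    rewrite /m expgS expg1 !mulgA -[(_ * y * s)%g]mulgA -sy !mulgA -expgSr x3 mul1g.
    by [].
  apply: eqN_trans (eqN_mull (zm _) IH) _.
  rewrite mulgA; apply: eqNM => //; first exact: commuteM.
  by rewrite mulnS; exact: mD.
apply: eqN_trans (eqN_mull (zm _) sj) _.
by rewrite mulgA; apply: eqNM => //; exact: commuteM.
Qed.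

Let acts_t : acts t (fun v => (v.1, v.1 + v.2)%N).
Proof.
split=> // -[i j]; rewrite /m /=.
have ti : eqN (t * x ^+ i)%g (m (i, i) * t)%g.
  elim: i => [|i IH]; first by rewrite /m !expg0 !mulg1 mul1g.
  have -> : (t * x ^+ i.+1 = m (1%N, 1%N) * (t * x ^+ i))%g.
    by rewrite /m expgS !expg1 mulgA tx !mulgA.
  apply: eqN_trans (eqN_mull (zm _) IH) _.
  by rewrite mulgA; apply: eqNM => //; exact: commuteM.
rewrite mulgA; apply: eqN_trans (eqN_mulr _ _ ti) _.
  by apply: commuteM => //; exact: commuteX.
rewrite -mulgA (commuteX j ty) mulgA; apply: eqNM => //; first by do ?apply: commuteM; do ?apply: commuteX.
have -> : (y ^+ j = m (0%N, j))%g by rewrite /m expg0 mul1g.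
by apply: eqN_trans (mD _ _) _; rewrite addn0.
Qed.

Let actsM g h Mg Mh : acts g Mg -> acts h Mh -> acts (g * h)%g (fun v => Mg (Mh v)).
Proof.
move=> [zg Hg] [zh Hh]; split=> [|v]; first exact: commuteM.
apply: (@eqN_trans _ (g * (m (Mh v) * h))%g); first by rewrite -mulgA; exact: eqNM.
by rewrite mulgA [X in eqN _ X]mulgA; apply: eqNM => //; exact: commuteM.
Qed.

Let F9 : seq (nat * nat) := [seq (i, j) | i <- iota 0 3, j <- iota 0 3].

Let avg := \sum_(v <- F9) N * rho (m v).

(** The permutation hypothesis says that v - M v runs over F_3^2 once, that is, that [g] fixes no
    nonzero vector. *)
Let conj_sum g M : acts g M ->
  perm_eq [seq ((v.1 + (M (2 * v.1, 2 * v.2)).1) %% 3,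
                (v.2 + (M (2 * v.1, 2 * v.2)).2) %% 3)%N | v <- F9] F9 ->
  \sum_(v <- F9) N * rho (m v) * rho g * rho (m (2 * v.1, 2 * v.2)%N) = avg * rho g.
Proof.
move=> [zg Hg] pM; rewrite /avg -[in RHS](perm_big _ pM) big_map mulr_suml; apply: eq_bigr => v _.
rewrite -!mulrA -!rhoM m_mod; apply: eqN_trans (eqN_mull (zm v) (Hg _)) _.
by rewrite mulgA; apply: eqNM; [exact: commuteM|exact: mD|].
Qed.

Lemma frobenius_absorb : N * rho x = N.
Proof.
have tinv := cube_inv t3; have sinv := cube_inv s3.
pose c a := \sum_(v <- F9) N * rho (m v) * a * rho (m (2 * v.1, 2 * v.2)%N).
have cD a b : c (a + b) = c a + c b.
  by rewrite /c -big_split; apply: eq_bigr => v _; rewrite mulrDr mulrDl.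
have c1 : c 1 = N *+ 9.
  rewrite /c (eq_bigr (fun=> N)) ?big_const_seq ?iter_addr_0 // => v _.
  rewrite mulr1 -mulrA -rhoM; apply: etrans (mD _ _) _.
  by rewrite -m_mod /= -!mulSn !modnMr /m !expg0 mulg1 /eqN rho1 mulr1.
have avgN : N *+ 9 = avg.
  have : c (quat_sum s t) = avg * quat_sum s t.
    by rewrite qst mulr0 /c big1 // => v _; rewrite mulr0 mul0r.
  have aX := actsM acts_s (actsM acts_t acts_t).
  have aY := actsM (actsM acts_s aX) (actsM acts_s acts_s).
  have aW := actsM (actsM acts_t acts_t) acts_s.
  have ast := actsM acts_s acts_t.
  have az := actsM ast (actsM ast ast).
  have ez : (quat_center s t = s * t * (s * t * (s * t)))%g.
    by rewrite quat_center.unlock !expgS expg0 mulg1.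
  rewrite /quat_sum mulrDl mul1r !mulrDr mulr1 -!rhoM !(cD, mulrDr avg) mulr1 c1 ez tinv sinv.
  rewrite /c.
  rewrite !(conj_sum aX, conj_sum aY, conj_sum aW, conj_sum az) //.
  rewrite !(conj_sum (actsM az aX), conj_sum (actsM az aY), conj_sum (actsM az aW)) //.
  (* The seven elements other than 1 contribute equally to both sides; what is left compares the
     contributions of 1. *)
  by move=> /addIr/addIr/addIr/addIr.
have avgx : avg * rho x = avg.
  rewrite /avg mulr_suml.
  have pF : perm_eq [seq ((v.1 + 1) %% 3, (v.2 + 0) %% 3)%N | v <- F9] F9 by [].
  rewrite -[RHS](perm_big _ pF) big_map.
  apply: eq_bigr => v _; rewrite -mulrA -rhoM -[x in LHS]expg1 -[(x ^+ 1)%g]mulg1.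
  have -> : (x ^+ 1 * 1 = m (1%N, 0%N))%g by [].
  by rewrite m_mod; exact: mD.
have : N * rho x *+ 9 = N *+ 9 by rewrite -mulrnAl avgN avgx.
by rewrite !(mulrnA _ 3 3) => /reg3/reg3.
Qed.

End FrobeniusAction.
End Representation.

(** * Transvections over the field with three elements *)

(* None, Some true and Some false stand for 0, 1 and -1; unlike 'F_3 this
   evaluates quickly. *)
Definition F3 := option bool.
Definition F3add (a b : F3) : F3 :=
  match a, b with
  | None, c | c, None => c
  | Some x, Some y => if x then if y then Some false else None else if y then None else Some true
  end.
Definition F3mul (a b : F3) : F3 :=
  match a, b with Some x, Some y => Some (if x then y else ~~ y) | _, _ => None end.
Definition F3opp (a : F3) : F3 := omap negb a.

Notation O := (None : F3).
Notation P := (Some true : F3).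
Notation M := (Some false : F3).

Definition vec := (F3 * F3 * F3 * F3)%type.
Definition vadd (p q : vec) : vec :=
  let: (p1, p2, p3, p4) := p in let: (q1, q2, q3, q4) := q in
  (F3add p1 q1, F3add p2 q2, F3add p3 q3, F3add p4 q4).
Definition vscale (c : F3) (p : vec) : vec :=
  let: (p1, p2, p3, p4) := p in (F3mul c p1, F3mul c p2, F3mul c p3, F3mul c p4).
Definition symp (p q : vec) : F3 :=
  let: (p1, p2, p3, p4) := p in let: (q1, q2, q3, q4) := q in
  F3add (F3add (F3mul p1 q2) (F3opp (F3mul p2 q1)))
        (F3add (F3mul p3 q4) (F3opp (F3mul p4 q3))).
(* The representative of the line of p whose first nonzero entry is 1. *)
Definition normal (p : vec) : vec :=
  match p with
  | (Some false, _, _, _) | (None, Some false, _, _)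
  | (None, None, Some false, _) | (None, None, None, Some false) => vscale (Some false) p
  | _ => p
  end.
(* Lines instead of vectors: transv p q represents the line of q + (q, p) p. *)
Definition transv (p q : vec) : vec := normal (vadd q (vscale (symp q p) p)).

Notation e1 := ((P, O, O, O) : vec).
Notation f1 := ((O, P, O, O) : vec).
Notation e2 := ((O, O, P, O) : vec).
Notation f2 := ((O, O, O, P) : vec).

(** The lines of the hyperbolic plane <e1, f1> are [e1], [f1], [v3], [v4]. The lines [x1], ..., [x4]
    form the graph of the anti-isometry e1 -> e2, f1 -> -f2; each projects to, and is orthogonal to,
    the corresponding one of those four. The scalar -1 on <e1, f1> carries [x1], [x2] to [y1],
    [y2]. *)
Notation v3 := ((P, P, O, O) : vec).
Notation v4 := ((P, M, O, O) : vec).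
Notation x1 := ((P, O, P, O) : vec).
Notation x2 := ((O, P, O, M) : vec).
Notation x3 := ((P, P, P, M) : vec).
Notation x4 := ((P, M, P, P) : vec).
Notation y1 := ((P, O, M, O) : vec).
Notation y2 := ((O, P, O, P) : vec).

(** * Collapse of a system of transvections *)

Section IdempotentCalculus.
Variables (R : pzRingType) (a b n z : R).
Hypotheses (ab : GRing.comm a b) (an : GRing.comm a n) (az : GRing.comm a z) (bz : GRing.comm b z).
Hypotheses (aa : a * a = a *+ 3) (bnb : b * n * b = b * (2 - z)) (zz : z * z = 1).

(** Meant for [a], [b] the sums N of two orthogonal lines and [n] that of a line orthogonal to the
    first of them. *)
Lemma sandwich_pair : a * b * n * (a * b) = a * b * (2 - z) *+ 3.
Proof.
have ba x : b * (a * x) = a * (b * x) by rewrite !mulrA ab.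
have na x : n * (a * x) = a * (n * x) by rewrite !mulrA an.
have -> : a * b * n * (a * b) = a * a * (b * n * b) by rewrite -!mulrA na ba.
by rewrite aa bnb mulrnAl !mulrA.
Qed.

Lemma one_add_mul_two_sub : (1 + z) * (2 - z) = 1 + z.
Proof.
rewrite mulrDl mul1r mulrBr zz mulr_natr !mulr2n.
by rewrite -(addrA z) -(addrA (1 + 1)) addKr addrCA addrK addrC.
Qed.

Lemma sandwich_pair_center (z' : R) : GRing.comm n z -> z' * n = z * n ->
  a * b * (1 + z') * n * (a * b) = a * b * (1 + z) *+ 3.
Proof.
move=> nz z'n; have -> : a * b * (1 + z') * n = (1 + z) * (a * b * n).
  rewrite -(mulrA (a * b)) (mulrDl 1 z') z'n -(mulrDl 1 z) mulrA [RHS]mulrA; congr (_ * _).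
  apply/commr_sym/commrM; first by apply/commr_sym/commrD => //; exact: commr1.
  by apply/commr_sym/commrD => //; exact: commr1.
rewrite -mulrA sandwich_pair mulrnAr; congr (_ *+ _).
have abz : GRing.comm (1 + z) (a * b).
  by apply: commrM; apply/commr_sym/commrD => //; exact: commr1.
rewrite mulrA abz -mulrA; congr (_ * _).
by rewrite one_add_mul_two_sub.
Qed.

Lemma sqr_2subr : (2 - z) * (2 - z) = 5 - z *+ 4.
Proof.
rewrite mulrBr !mulrBl zz -natrM mulr_natl mulr_natr opprB addrACA -opprD -mulrnDr.
by rewrite -natr1 addrC.
Qed.

End IdempotentCalculus.

(* The square of f u f is 9 f (5 - 4c) by the first identity for f and u, and
   81 f (c - 2)^2 = 81 f (5 - 4c) by the second; finally 5 - 4c divides 9. *)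
Lemma idempotent_collapse (R : pzRingType) (f c u : R) :
  injective (fun x : R => x *+ 2) -> injective (fun x : R => x *+ 3) ->
  f * f = f *+ 9 -> GRing.comm f c -> c * c = 1 ->
  f * (u * f * u) * f = f * (5 - c *+ 4) -> f * u * f = f * (c - 2) *+ 3 -> f = 0.
Proof.
move=> reg2 reg3 ff fc cc fo fu; set h := 5 - c *+ 4 in fo.
have reg2' (x : R) : x *+ 2 = 0 -> x = 0 by rewrite -[RHS](mul0rn _ 2) => /reg2.
have reg3' (x : R) : x *+ 3 = 0 -> x = 0 by rewrite -[RHS](mul0rn _ 3) => /reg3.
have fh : f * h = 0.
  have e : f * h *+ 9 = f * h *+ 81.
    transitivity (f * u * f * (f * u * f)).
      rewrite -fo; transitivity (f * u * (f * f) * (u * f)); last by rewrite !mulrA.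
      by rewrite ff mulrnAr mulrnAl !mulrA.
    have fc2 : GRing.comm f (c - 2) by apply: commrB => //; exact: commr_nat.
    rewrite fu mulrnAl mulrnAr -mulrnA.
    have -> : f * (c - 2) * (f * (c - 2)) = f * f * ((c - 2) * (c - 2)).
      by rewrite -!mulrA; congr (_ * _); rewrite !mulrA fc2.
    by rewrite -[c - 2]opprB mulrNN sqr_2subr // ff mulrnAl -mulrnA.
  apply/reg2'/reg2'/reg2'/reg3'/reg3'.
  by rewrite -!mulrnA -[LHS](addrK (f * h *+ 9)) -mulrnDr e subrr.
have hh : h * (5 + c *+ 4) = 9.
  have dd : c *+ 4 * (c *+ 4) = 16%:R by rewrite mulrnAl mulrnAr cc -mulrnA.
  rewrite /h; move: (c *+ 4) dd => d dd.
  rewrite mulrBl (mulrDr 5 5 d) (mulrDr d 5 d) dd (commr_nat d 5) opprD.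
  by rewrite (addrA (_ + _)) addrK -natrM -natrB.
apply/reg3'/reg3'; by rewrite -mulrnA -mulr_natr -hh mulrA fh mul0r.
Qed.

Section TransvectionSystem.
Variables (G : groupType) (R : pzRingType) (rho : G -> R).
Hypotheses (rho1 : rho 1%g = 1) (rhoM : {morph rho : x y / (x * y)%g >-> x * y}).
Hypothesis reg2 : injective (fun x : R => x *+ 2).
Hypothesis reg3 : injective (fun x : R => x *+ 3).

Let natmul2_eq0 (x : R) : x *+ 2 = 0 -> x = 0.
Proof. by rewrite -[X in _ = X](mul0rn _ 2) => /reg2. Qed.

Let natmul3_eq0 (x : R) : x *+ 3 = 0 -> x = 0.
Proof. by rewrite -[X in _ = X](mul0rn _ 3) => /reg3. Qed.

Let natmul4_eq0 (x : R) : x *+ 4 = 0 -> x = 0.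
Proof. by rewrite (mulrnA _ 2 2) => /natmul2_eq0/natmul2_eq0. Qed.

(* T maps each line of F_3^4 to an element of order dividing 3, compatibly with the
   conjugation of transvections; systemL, the triviality of a product over the four
   lines of an isotropic plane, kills the central factor of Gamma_5 that commutes
   with all of them. *)
Record system (T : vec -> G) : Prop := System {
  system3 : forall p, (T p ^+ 3 = 1)%g;
  systemJ : forall p q, (T p * T q = T (transv p q) * T p)%g;
  systemL : (T e1 * T e2 * T (P, O, P, O) * T (P, O, M, O) = 1)%g;
  systemQ : quat_sum rho (T e1) (T f1) = 0 }.

Lemma systemJV T p q : system T -> (T (transv p q) = T p * T q * (T p)^-1)%g.
Proof. by move=> sT; rewrite (systemJ sT) mulgK. Qed.

Lemma quat_centerJ (g s t : G) :
  (quat_center (g * s * g^-1) (g * t * g^-1) = g * quat_center s t * g^-1)%g.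
Proof. by rewrite !quat_center.unlock !expgS expg0 !mulg1 !mulgA !mulgVK. Qed.

Lemma quat_sumJ (g s t : G) :
  quat_sum rho (g * s * g^-1)%g (g * t * g^-1)%g = rho g * quat_sum rho s t * rho g^-1%g.
Proof.
have rhoJ h : rho (g * h * g^-1)%g = rho g * rho h * rho g^-1%g by rewrite !rhoM.
have e1J : 1 = rho g * 1 * rho g^-1%g by rewrite mulr1 (rhoKV rho1 rhoM).
rewrite /quat_sum quat_centerJ.
have -> : (g * s * g^-1 * (g * t * g^-1)^-1 = g * (s * t^-1) * g^-1)%g.
  by rewrite !invgM invgK !mulgA mulgVK.
have -> : ((g * t * g^-1)^-1 * (g * s * g^-1) = g * (t^-1 * s) * g^-1)%g.
  by rewrite !invgM invgK !mulgA mulgVK.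
have -> : (g * s * g^-1 * (g * (s * t^-1) * g^-1) * (g * s * g^-1)^-1
   = g * (s * (s * t^-1) * s^-1) * g^-1)%g.
  by rewrite !invgM invgK !mulgA !mulgVK.
rewrite !rhoJ {1 2}e1J -!mulrDl -!mulrDr -!mulrA [rho g^-1%g * (rho g * _)]mulrA.
by rewrite (rhoVK rho1 rhoM) mul1r.
Qed.

(* Transporting a system along transvections turns an identity about fixed lines
   into the same identity about their images; the lists of vectors given below are
   words of transvections carrying the former to the latter. *)
Definition transvs (rs : seq vec) (p : vec) : vec := foldr transv p rs.

(** [T \o transv r] is [T] followed by conjugation by [T r]. *)
Lemma system_transvs rs T : system T -> system (T \o transvs rs).
Proof.
elim: rs T => // r rs IH T sT; apply: (IH (T \o transv r)) => {IH rs}.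
have TJ := systemJV r _ sT.
split=> [p|p q||] /=; rewrite !TJ.
- have -> : ((T r * T p * (T r)^-1) ^+ 3 = T r * T p ^+ 3 * (T r)^-1)%g.
    by rewrite !expgS !expg0 !mulg1 !mulgA !mulgVK.
  by rewrite (system3 sT) mulg1 mulgV.
- by rewrite !mulgA !mulgVK -[(_ * T p * T q)%g]mulgA (systemJ sT p q) !mulgA.
- rewrite !mulgA !mulgVK -!mulgA [(T e1 * _)%g]mulgA [(T e1 * _ * _)%g]mulgA.
  by rewrite [(T e1 * _ * _ * _)%g]mulgA (systemL sT) mul1g mulgV.
- by rewrite quat_sumJ (systemQ sT) mulr0 mul0r.
Qed.

Local Notation N T p := (cyc_sum rho (T p)).
Local Notation z T p q := (rho (quat_center (T p) (T q))).

Lemma system_braid T : system T -> (T e1 * T f1 * T e1 = T f1 * T e1 * T f1)%g.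
Proof.
move=> sT; pose q : vec := (P, M, O, O).
have a : (T e1 * T f1 = T q * T e1)%g := systemJ sT e1 f1.
have b : (T q * T e1 = T f1 * T q)%g := systemJ sT q e1.
by rewrite {1}a b -!mulgA -a.
Qed.

Lemma system_commute T p q : system T -> transv p q = q -> commute (T p) (T q).
Proof. by move=> sT pq; rewrite /commute (systemJ sT) pq. Qed.

Definition swap_planes : seq vec := [:: (P, M, P, M); (P, O, P, O); (O, P, O, P)].

Lemma mulVg_swap (g h k k' c : G) :
  (h * k = c * h -> g * k' = c * g -> (g^-1 * h) * k = k' * (g^-1 * h))%g.
Proof.
move=> hk gk; rewrite -mulgA hk !mulgA; congr (_ * _)%g.
by apply: (mulgI g); rewrite !mulgA mulgV mul1g gk mulgK.
Qed.

(* In Sp_4(3), the stabiliser of the line e1 has as unipotent radical an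
   extraspecial group of centre T e1, on which <T e2, T f2> acts. *)
Lemma cyc_sum_absorb T : system T -> N T e1 * rho (T e2) = N T e1 * rho (T (P, O, P, O)).
Proof.
move=> sT; have sT' := system_transvs swap_planes sT.
have cT p q : transv p q = q -> commute (T p) (T q) := system_commute sT.
have T3 := system3 sT.
pose a0 := T e2; pose a1 := T (P, O, P, O); pose a2 := T (P, O, M, O).
pose b0 := T f2; pose b1 := T (P, O, O, P).
have ca01 : commute a0 a1 := cT e2 (P, O, P, O) erefl.
have cb01 : commute b0 b1 := cT f2 (P, O, O, P) erefl.
have za0 : commute (T e1) a0 := cT e1 e2 erefl.
have za1 : commute (T e1) a1 := cT e1 (P, O, P, O) erefl.
have zb0 : commute (T e1) b0 := cT e1 f2 erefl.
have zb1 : commute (T e1) b1 := cT e1 (P, O, O, P) erefl.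
have cVM (g h k : G) : commute g h -> commute g k -> commute g (h^-1 * k)%g.
  by move=> gh gk; apply/commuteM/gk/commuteV.
have cubeM (g h : G) : commute g h -> (g ^+ 3 = 1 -> h ^+ 3 = 1 -> (g^-1 * h) ^+ 3 = 1)%g.
  move=> gh g3 h3; rewrite expgMn ?expVgn ?g3 ?h3 ?invg1 ?mulg1 //.
  exact/commute_sym/commuteV/commute_sym.
(* Transvections along lines congruent modulo [e1] agree on e1^perp / e1, so their quotients lie in
   the unipotent radical. *)
pose x := (a0^-1 * a1)%g; pose y := (b0^-1 * b1)%g.
have xb : (x * b1 = b0 * x)%g.
  exact: (mulVg_swap (systemJ sT (P, O, P, O) (P, O, O, P)) (systemJ sT e2 f2)).
have ya : (y * a0 = a1 * y)%g.
  exact: (mulVg_swap (systemJ sT (P, O, O, P) e2) (systemJ sT f2 (P, O, P, O))).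
have ya' : (y * a1 = a2 * y)%g.
  exact: (mulVg_swap (systemJ sT (P, O, O, P) (P, O, P, O)) (systemJ sT f2 (P, O, M, O))).
have xa : (x * a0 = a1)%g by rewrite /x -mulgA -ca01 mulKg.
have yb : (y * b0 = b1)%g by rewrite /y -mulgA -cb01 mulKg.
(* [systemL] is what makes the commutator of [x] and [y] equal to [T e1]. *)
have yxz : (y * x * T e1 = x * y)%g.
  have yV : (y * a0^-1 = a1^-1 * y)%g.
    by apply: (mulIg a0); rewrite mulgVK -mulgA ya mulKg.
  have a2z : (a2 * T e1 = a1^-1 * a0^-1)%g.
    have := systemL sT; rewrite -/a0 -/a1 -/a2 => L.
    apply: (mulgI (T e1 * a0 * a1)%g); rewrite mulgA L mul1g.
    by rewrite !mulgA mulgK mulgK.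
  have zy : commute (T e1) y by exact: cVM.
  rewrite /x mulgA yV -2!mulgA [(y * (_ * _))%g]mulgA ya' -[(a2 * y * _)%g]mulgA -zy.
  rewrite [(a2 * _)%g]mulgA a2z !mulgA; congr (_ * _)%g.
  have -> : (a1^-1 * a1^-1 = a1)%g by rewrite -cube_inv ?invgK // expVgn T3 invg1.
  by congr (_ * _)%g; apply/commuteV/commute_sym.
have Nx : N T e1 * rho x = N T e1.
  apply: (@frobenius_absorb _ _ _ rho1 rhoM (T e1) x y a0 b0) => //.
  - exact: cubeM (T3 _) (T3 _).
  - exact: cubeM (T3 _) (T3 _).
  - exact: T3.
  - exact: T3.
  - exact: cVM.
  - exact: cVM.
  - exact: cVM.
  - by rewrite xa ya.
  - by rewrite -xb -[(x * y * b0)%g]mulgA yb.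
  - exact: cVM.
  - exact: systemQ sT'.
by rewrite -/a0 -/a1 -xa rhoM mulrA Nx.
Qed.

(** * Hyperbolic planes and their involutions *)

Lemma sum_plane T : system T ->
  (1 + z T e1 f1) * (N T e1 + N T f1 + N T (P, M, O, O) + N T (P, P, O, O))
  = (1 + z T e1 f1) *+ 4.
Proof.
move=> sT; have := sum_lines rho1 rhoM (system3 sT e1) (system3 sT f1) (system_braid sT) (systemQ sT).
rewrite -(systemJV e1 f1 sT) -[((T e1)^-1 * _ * _)%g]mulgA.
by rewrite -(systemJ sT e1 (P, P, O, O) : _ = T f1 * T e1)%g mulKg.
Qed.

Lemma sandwich T : system T -> N T e1 * N T f1 * N T e1 = N T e1 * (2 - z T e1 f1).
Proof.
move=> sT; apply: (cyc_sum_sandwich rho1 rhoM) (systemQ sT) _ _ => //; try exact: system3 sT _.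
exact: system_braid.
Qed.

Lemma zK T : system T -> z T e1 f1 * z T e1 f1 = 1.
Proof.
by move=> sT; apply: (quat_centerK rho1 rhoM) (system_braid sT); exact: system3 sT _.
Qed.

Lemma quat_center_comm (s t g : G) : commute s g -> commute t g -> commute (quat_center s t) g.
Proof.
move=> sg tg; rewrite quat_center.unlock.
by apply/commute_sym/commuteX/commuteM; exact: commute_sym.
Qed.

(** Conjugation by [T e1] fixes the involution and permutes the other three lines of the plane. *)
Lemma quat_center_plane T : system T ->
  [/\ quat_center (T f1) (T e1) = quat_center (T e1) (T f1),
      quat_center (T e1) (T (P, M, O, O)) = quat_center (T e1) (T f1) &
      quat_center (T e1) (T (P, P, O, O)) = quat_center (T e1) (T f1)].
Proof.
move=> sT; split; first exact: quat_centerC (system_braid sT).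
  rewrite -{1}[T e1](mulgK (T e1)) (systemJV e1 f1 sT : T (P, M, O, O) = _) quat_centerJ.
  by rewrite -(quat_centerCs (system_braid sT)) mulgK.
have -> : T (P, P, O, O) = ((T e1)^-1 * T f1 * (T e1)^-1^-1)%g.
  by rewrite invgK -mulgA -(systemJ sT e1 (P, P, O, O) : _ = T f1 * T e1)%g mulKg.
have e : T e1 = ((T e1)^-1 * T e1 * (T e1)^-1^-1)%g by rewrite invgK mulVg mul1g.
rewrite {1}e quat_centerJ.
by rewrite invgK -mulgA (quat_centerCs (system_braid sT)) mulKg.
Qed.

Lemma quat_center_plane_f1 T : system T ->
  quat_center (T v3) (T f1) = quat_center (T e1) (T f1) /\
  quat_center (T v4) (T f1) = quat_center (T e1) (T f1).
Proof.
move=> sT; have [zC _ _] := quat_center_plane sT.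
have [_ z3 z4] := quat_center_plane (system_transvs [:: (P, P, O, O); (O, P, O, O); (O, P, O, O)] sT).
have [z3C _ _] := quat_center_plane (system_transvs [:: (O, P, O, O)] sT).
have [z4C _ _] := quat_center_plane (system_transvs [:: (O, P, O, O); (O, P, O, O)] sT).
split; first exact: etrans (esym z3C) (etrans z3 zC).
exact: etrans (esym z4C) (etrans z4 zC).
Qed.

(** The lines [q] are those of <e1, f1 - e2> other than [e1]. An element [x] absorbed by [N T e1]
    carries <e1, f1> to that plane, hence one involution to the other. *)
Lemma cyc_sum_quat_center T q : system T ->
  q \in [:: (P, M, P, O); (O, P, M, O); (P, P, M, O)] ->
  N T e1 * z T e1 q = N T e1 * z T e1 f1.
Proof.
move=> sT qI; have := quat_center_plane (system_transvs [:: (P, O, P, O)] sT).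
move=> [_ /= q3 q2].
have -> : z T e1 q = z T e1 (P, M, P, O).
  by move: qI; rewrite !inE => /or3P[] /eqP-> //; congr rho; [exact: q2|exact: q3].
pose a0 := T e2; pose a1 := T (P, O, P, O).
have ca01 : commute a0 a1 := system_commute sT (erefl : transv e2 (P, O, P, O) = _).
pose x := (a0^-1 * a1)%g.
have Nx : N T e1 * rho x = N T e1.
  have -> : x = (a1 * a0^-1)%g by apply/commute_sym/commuteV/commute_sym.
  by rewrite rhoM mulrA -(cyc_sum_absorb sT) -mulrA (rhoKV rho1 rhoM) mulr1.
have xf : (x * T f1 = T (P, M, P, O) * x)%g.
  exact: mulVg_swap (systemJ sT (P, O, P, O) f1) (systemJ sT e2 (P, M, P, O)).
have xe : (x * T e1 = T e1 * x)%g.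
  exact: mulVg_swap (systemJ sT (P, O, P, O) e1) (systemJ sT e2 e1).
have xz : (x * quat_center (T e1) (T f1) = quat_center (T e1) (T (P, M, P, O)) * x)%g.
  by rewrite -[T (P, M, P, O)](mulgK x) -xf -[in RHS](mulgK x (T e1)) -xe quat_centerJ mulgVK.
have c : GRing.comm (z T e1 (P, M, P, O)) (N T e1).
  apply/cyc_sum_comm/rhoC => //.
  exact: quat_centerCs (system_braid (system_transvs [:: (P, O, P, O)] sT)).
by rewrite -{2}Nx -mulrA -rhoM xz rhoM mulrA -c -mulrA Nx.
Qed.

(* By cyc_sum_absorb, this product depends only on the isotropic plane through the
   two lines. *)
Definition F T := N T x1 * N T x2.

(** * The product over an isotropic plane *)

Lemma cyc_sum_commute T p q : system T -> transv p q = q -> GRing.comm (N T p) (N T q).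
Proof. by move=> sT pq; apply/(cyc_sumC rhoM)/system_commute. Qed.

Lemma z_commute T p q r : system T -> transv p r = r -> transv q r = r ->
  GRing.comm (z T p q) (N T r).
Proof.
by move=> sT pr qr; apply/cyc_sum_comm/rhoC/quat_center_comm => //; exact: system_commute.
Qed.

Lemma z_commute2 T : system T -> GRing.comm (z T e1 f1) (N T e1) /\ GRing.comm (z T e1 f1) (N T f1).
Proof.
move=> sT; split; apply/cyc_sum_comm/rhoC => //.
  exact: quat_centerCs (system_braid sT).
exact: quat_centerCt (system_braid sT).
Qed.

(** [N T x1] commutes with [N T e1], which [N T x2] sandwiches. Next to [N T e1] the involutions of
    <e1, f1> and <e1, x2> agree, and (1 + z)(2 - z) = 1 + z. *)
Lemma F_sandwich1 T : system T ->
  F T * (1 + z T e1 f1) * N T e1 * F T = F T * (1 + z T x2 e1) *+ 3.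
Proof.
move=> sT; pose w : seq vec := [:: (P, P, O, O); (O, P, O, M); (O, P, O, O)].
have sw := system_transvs w sT.
have [zc _ _] := quat_center_plane sw.
have [zx2 ze1] := z_commute2 sw.
have S : N T x2 * N T e1 * N T x2 = N T x2 * (2 - z T x2 e1) := sandwich sw.
have Z : N T e1 * z T e1 x2 = N T e1 * z T e1 f1 :=
  @cyc_sum_quat_center _ (O, P, M, O) (system_transvs [:: (O, O, P, M)] sT) isT.
apply: sandwich_pair_center => //.
- exact: (@cyc_sum_commute _ x1 x2).
- exact: (@cyc_sum_commute _ x1 e1).
- exact/commr_sym/z_commute.
- exact: (cyc_sum_sq rho1 rhoM (system3 sT _)).
- exact: zK sw.
have zE : z T e1 x2 = z T x2 e1 := congr1 rho zc.
have ze : GRing.comm (z T x2 e1) (N T e1) := ze1.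
by rewrite ze -zE Z; case: (z_commute2 sT).
Qed.

Lemma F_change T : system T -> N T e1 * N T e2 = N T e1 * N T x1.
Proof.
move=> sT; have a := cyc_sum_absorb sT.
have c1 : GRing.comm (N T e1) (rho (T x1)).
  by apply/commr_sym/cyc_sum_comm/rhoC/(@system_commute _ x1 e1).
rewrite (cyc_sumE rhoM (T e2)) (cyc_sumE rhoM (T x1)) !(mulrDr (N T e1)) a; congr (_ + _).
by rewrite !mulrA a c1 -mulrA a mulrA.
Qed.

Lemma F_lines T : system T ->
  [/\ N T x2 * N T x1 = F T, N T x3 * N T x2 = F T, N T x4 * N T x2 = F T
    & N T x3 * N T x1 = F T].
Proof.
move=> sT; pose t w := F_change (system_transvs w sT).
have a3 : N T x2 * N T x1 = N T x2 * N T x3 :=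
  t [:: (P, O, O, P); (O, P, O, O); (O, O, O, P); (O, O, O, P)].
have a4 : N T x2 * N T x1 = N T x2 * N T x4 := t [:: (P, M, O, P); (P, O, M, P); (O, O, O, P)].
have a31 : N T x1 * N T x2 = N T x1 * N T x3 := t [:: (P, M, P, O); (O, P, P, O); (O, O, O, P)].
rewrite /F (@cyc_sum_commute _ x3 x2) // -a3 (@cyc_sum_commute _ x4 x2) // -a4.
by rewrite (@cyc_sum_commute _ x3 x1) // -a31 (@cyc_sum_commute _ x2 x1).
Qed.

Lemma z_x2 T p : system T -> p \in [:: v3; v4; y1] -> N T x2 * z T x2 p = N T x2 * z T x2 e1.
Proof.
move=> sT; rewrite !inE => /or3P[] /eqP->.
- exact: (@cyc_sum_quat_center _ (P, M, P, O)
    (system_transvs [:: (P, M, M, M); (P, M, P, P); (O, P, M, O)] sT) isT).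
- exact: (@cyc_sum_quat_center _ (P, P, M, O)
    (system_transvs [:: (P, M, M, O); (P, M, P, O); (O, P, M, P); (O, O, P, P)] sT) isT).
- exact: (@cyc_sum_quat_center _ (O, P, M, O)
    (system_transvs [:: (P, P, O, O); (O, P, O, P); (O, P, O, P); (O, O, O, P)] sT) isT).
Qed.

Lemma z_x1 T p : system T -> p \in [:: v3; v4; y2] -> N T x1 * z T x1 p = N T x1 * z T x1 f1.
Proof.
move=> sT; rewrite !inE => /or3P[] /eqP->.
- exact: (@cyc_sum_quat_center _ (P, P, M, O)
    (system_transvs [:: (O, P, P, O); (O, P, O, O); (O, P, O, O)] sT) isT).
- exact: (@cyc_sum_quat_center _ (P, M, P, O) (system_transvs [:: (O, P, M, P); (O, P, O, P)] sT) isT).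
- exact: (@cyc_sum_quat_center _ (O, P, M, O)
    (system_transvs [:: (O, P, M, P); (O, P, O, P); (O, O, O, P); (O, O, O, P)] sT) isT).
Qed.

Lemma F_z_x2 T p : system T -> p \in [:: v3; v4; y1] -> F T * z T x2 p = F T * z T x2 e1.
Proof. by move=> sT pI; rewrite /F -!mulrA z_x2. Qed.

Lemma F_z_x1 T p : system T -> p \in [:: v3; v4; y2] -> F T * z T x1 p = F T * z T x1 f1.
Proof. by move=> sT pI; have [<- _ _ _] := F_lines sT; rewrite -!mulrA z_x1. Qed.

(** Evaluate [F T * N T v3 * F T] with F written on [x3], [x1] and on [x3], [x2]; the line [x3] is
    orthogonal to [v3]. *)
Lemma F_z_link T : system T -> F T * z T x1 f1 = F T * z T x2 e1.
Proof.
move=> sT; have [F21 F32 _ F31] := F_lines sT; have T3 := system3 sT.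
have c p q (pq : transv p q = q) := cyc_sum_commute sT pq.
have sq p := cyc_sum_sq rho1 rhoM (T3 p).
have S2 : N T x2 * N T v3 * N T x2 = N T x2 * (2 - z T x2 v3) :=
  sandwich (system_transvs [:: (P, M, O, O); (O, P, P, P); (O, P, P, O)] sT).
have S1 : N T x1 * N T v3 * N T x1 = N T x1 * (2 - z T x1 v3) :=
  sandwich (system_transvs [:: (P, M, O, O); (O, P, M, O)] sT).
have := sandwich_pair (c x3 x2 erefl) (c x3 v3 erefl) (sq x3) S2.
have := sandwich_pair (c x3 x1 erefl) (c x3 v3 erefl) (sq x3) S1.
rewrite F31 F32 => -> /reg3; rewrite !mulrBr => /addrI/oppr_inj.
by rewrite F_z_x1 // F_z_x2.
Qed.

(** F is rewritten on two lines of its plane, the first orthogonal to [p]; the involutions that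
    appear agree after multiplication by F. *)
Lemma F_sandwich T p : system T -> p \in [:: e1; f1; v3; v4] ->
  F T * (1 + z T e1 f1) * N T p * F T = F T * (1 + z T x2 e1) *+ 3.
Proof.
move=> sT; have [F21 F32 F42 _] := F_lines sT.
have t w := F_sandwich1 (system_transvs w sT).
have [zC _ _] := quat_center_plane sT; have [z3f z4f] := quat_center_plane_f1 sT.
rewrite !inE => /or4P[] /eqP->.
- exact: F_sandwich1.
- have : N T x2 * N T x1 * (1 + z T f1 e1) * N T f1 * (N T x2 * N T x1) =
    N T x2 * N T x1 * (1 + z T x1 f1) *+ 3 :=
    t [:: (P, P, O, O); (O, P, M, P); (O, P, P, M); (O, O, O, P)].
  by rewrite F21 zC => ->; rewrite !(mulrDr (F T)) F_z_link.
- have : N T x3 * N T x2 * (1 + z T v3 f1) * N T v3 * (N T x3 * N T x2) =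
    N T x3 * N T x2 * (1 + z T x2 v3) *+ 3 :=
    t [:: (O, P, O, O); (O, O, O, P); (O, O, O, P)].
  rewrite F32 z3f => ->.
  by rewrite !(mulrDr (F T)) F_z_x2.
- have : N T x4 * N T x2 * (1 + z T v4 f1) * N T v4 * (N T x4 * N T x2) =
    N T x4 * N T x2 * (1 + z T x2 v4) *+ 3 :=
    t [:: (O, P, O, O); (O, P, O, O); (O, O, O, P)].
  rewrite F42 z4f => ->.
  by rewrite !(mulrDr (F T)) F_z_x2.
Qed.

Lemma F_sq T : system T -> F T * F T = F T *+ 9.
Proof.
move=> sT; have sq p := cyc_sum_sq rho1 rhoM (system3 sT p).
have [F21 _ _ _] := F_lines sT.
by rewrite -{2}F21 /F !mulrA -[_ * _ * N T x2]mulrA sq mulrnAr mulrnAl -mulrA F21 /F mulrA sq mulrnAl -mulrnA.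
Qed.

Lemma F_z_comm T : system T -> GRing.comm (F T) (z T x2 e1).
Proof.
move=> sT; have sw := system_transvs [:: (P, P, O, O); (O, P, O, M); (O, P, O, O)] sT.
have c : GRing.comm (z T x2 e1) (N T x2) := (z_commute2 sw).1.
apply/commr_sym/commrM => //; exact: z_commute.
Qed.

Lemma zK_x2 T : system T -> z T x2 e1 * z T x2 e1 = 1.
Proof.
by move=> sT; apply: zK (system_transvs [:: (P, P, O, O); (O, P, O, M); (O, P, O, O)] sT).
Qed.

(** Summing [F_sandwich] over the four lines of <e1, f1> turns [sum_plane] into a value of F (1 + z)
    F, from which F F = 9 F is subtracted. *)
Lemma F_z_F T : system T -> F T * z T e1 f1 * F T = F T * (z T x2 e1 - 2) *+ 3.
Proof.
move=> sT; have FF := F_sq sT.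
have e : F T * (1 + z T e1 f1) * F T *+ 4 = F T * (1 + z T x2 e1) *+ 3 *+ 4.
  rewrite -mulrnAl -mulrnAr -(sum_plane sT) mulrA 3!(mulrDr (F T * _)) 3!(mulrDl _ _ (F T)).
  by rewrite !F_sandwich // !(mulrS (_ *+ 3)) mulr0n addr0 !addrA.
have {}e : F T *+ 9 + F T * z T e1 f1 * F T = F T * (1 + z T x2 e1) *+ 3.
  by rewrite -FF -mulrDl -{1}[F T]mulr1 -mulrDr; apply/reg2/reg2; rewrite -!(mulrnA _ 2 2).
apply: (addrI (F T *+ 9)); rewrite e mulrDr mulr1 mulrBr mulrnDl mulrnBl mulr_natr -mulrnA.
by rewrite [RHS]addrCA addrC; congr (_ + _); rewrite -mulrnBr.
Qed.

Lemma transvs_act rs T p : system T ->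
  (foldr (fun r g => T r * g) 1 rs * T p = T (transvs rs p) * foldr (fun r g => T r * g) 1 rs)%g.
Proof.
move=> sT; elim: rs => [|r rs IH] /=; first by rewrite mul1g mulg1.
by rewrite -mulgA IH !mulgA (systemJ sT).
Qed.

Lemma quat_center_act T p : system T ->
  (quat_center (T e1) (T f1) * T p
   = T (transvs [:: e1; f1; e1; f1; e1; f1] p) * quat_center (T e1) (T f1))%g.
Proof.
set w := [:: _, _ & _] => sT.
have -> : quat_center (T e1) (T f1) = foldr (fun r g => T r * g)%g 1%g w.
  by rewrite quat_center.unlock /= !expgS expg0 mulg1 -!mulgA mulg1.
exact: transvs_act.
Qed.

Lemma F_opposite T : system T -> z T e1 f1 * F T * z T e1 f1 = N T y1 * N T y2.
Proof.
move=> sT; pose w : seq vec := [:: e1; f1; e1; f1; e1; f1].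
have zT p : z T e1 f1 * N T p = N T (transvs w p) * z T e1 f1.
  have -> : T (transvs w p) = (quat_center (T e1) (T f1) * T p * (quat_center (T e1) (T f1))^-1)%g.
    by rewrite quat_center_act // mulgK.
  by rewrite (cyc_sumJ rho1 rhoM) -!mulrA rhoVK // mulr1.
by rewrite /F mulrA zT -(mulrA (N T _)) zT -!mulrA zK // mulr1.
Qed.

(** [y1] is orthogonal to [x1] and [y2] to [x2], so the product splits into two sandwiches, with
    factors 2 - z that agree next to F; (2 - z)^2 = 5 - 4 z. *)
Lemma F_opposite_sandwich T : system T ->
  F T * (N T y1 * N T y2) * F T = F T * (5 - z T x2 e1 *+ 4).
Proof.
move=> sT.
have c p q (pq : transv p q = q) := cyc_sum_commute sT pq.
have S1 : N T x1 * N T y2 * N T x1 = N T x1 * (2 - z T x1 y2) :=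
  sandwich (system_transvs [:: (P, M, P, P); (P, M, P, O); (O, P, P, O)] sT).
have S2 : N T x2 * N T y1 * N T x2 = N T x2 * (2 - z T x2 y1) :=
  sandwich (system_transvs [:: (P, P, P, M); (P, O, O, P); (O, P, O, O)] sT).
have -> : F T * (N T y1 * N T y2) * F T =
   (N T x1 * N T y2 * N T x1) * (N T x2 * N T y1 * N T x2).
  rewrite /F -!mulrA; congr (_ * _).
  rewrite (mulrA (N T y1)) (c y1 y2) // !mulrA (c x2 y2) // -!mulrA; congr (_ * _).
  by rewrite !mulrA -(mulrA _ (N T y1)) (c y1 x1) // mulrA (c x2 x1) // -!mulrA.
have -> : N T x1 * N T y2 * N T x1 * (N T x2 * N T y1 * N T x2) =
   F T * (2 - z T x1 y2) * (2 - z T x2 y1).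
  have zb : GRing.comm (2 - z T x1 y2) (N T x2).
    by apply/commr_sym/commrB; [exact: commr_nat|exact/commr_sym/z_commute].
  by rewrite S1 S2 mulrA -(mulrA _ _ (N T x2)) zb /F !mulrA.
have Fc : (2 - z T x2 e1) * F T = F T * (2 - z T x2 e1).
  by apply/commr_sym/commrB; [exact: commr_nat|exact: F_z_comm].
have -> : F T * (2 - z T x1 y2) = (2 - z T x2 e1) * F T.
  by rewrite Fc !(mulrBr (F T)) F_z_x1 // F_z_link.
rewrite -mulrA (mulrBr (F T) 2 (z T x2 y1)) F_z_x2 // -(mulrBr (F T)) mulrA Fc -mulrA.
by rewrite sqr_2subr // zK_x2.
Qed.

(** * Vanishing of [F] and the value of the involutions *)

Lemma F_eq0 T : system T -> F T = 0.
Proof.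
move=> sT; have FF := F_sq sT; have Fz := F_z_comm sT; have zz := zK_x2 sT.
have := F_z_F sT; have := F_opposite_sandwich sT; have := F_opposite sT.
by move=> <-; move: (F T) FF Fz => f ff fc Fo Fu; exact: (idempotent_collapse reg2 reg3 ff fc zz Fo Fu).
Qed.

Lemma cyc_sum_perp T q : system T -> q \in [:: e2; f2; (O, O, P, P); (O, O, P, M)] ->
  N T e1 * N T q = 0.
Proof.
move=> sT; have t w : F (T \o transvs w) = 0 := F_eq0 (system_transvs w sT).
pose L : seq vec := [:: (P, M, O, O); (O, P, M, M); (O, O, O, P)].
rewrite !inE => /or4P[] /eqP->.
- exact: t L.
- exact: t ((O, O, P, M) :: L).
- exact: t ((O, O, O, P) :: L).
- exact: t ((O, O, P, P) :: L).
Qed.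

(** Multiplying [sum_plane] for <e2, f2> by [N T e1] kills its left-hand side. *)
Lemma cyc_sum_z_perp T : system T -> N T e1 * (1 + z T e2 f2) = 0.
Proof.
move=> sT; have := sum_plane (system_transvs swap_planes sT).
rewrite -/(1 + z T e2 f2).
have zc : GRing.comm (N T e1) (1 + z T e2 f2).
  by apply: commrD; [exact: commr1|apply/commr_sym; exact: z_commute].
move/(congr1 (fun x => N T e1 * x)); rewrite /= mulrA.
have -> : N T e1 * (1 + z (T \o transvs swap_planes) e1 f1) = (1 + z T e2 f2) * N T e1 := zc.
rewrite -mulrA.
have -> : N T e1 * (N T e2 + N T f2 + N T (O, O, P, M) + N T (O, O, P, P)) = 0.
  by rewrite !(mulrDr (N T e1)) !cyc_sum_perp // !addr0.
by rewrite mulr0 mulrnAr => /esym e; apply: natmul4_eq0; rewrite -zc; exact: e.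
Qed.

Lemma z_perp T : system T -> (1 + z T e1 f1) * (1 + z T e2 f2) = 0.
Proof.
move=> sT; have t w := cyc_sum_z_perp (system_transvs w sT).
have p1 : N T f1 * (1 + z T e2 f2) = 0 := t [:: (P, M, O, O)].
have p3 : N T v3 * (1 + z T e2 f2) = 0 := t [:: (O, P, O, O)].
have p4 : N T v4 * (1 + z T e2 f2) = 0 := t [:: (P, P, O, O)].
have := congr1 (fun x => x * (1 + z T e2 f2)) (sum_plane sT).
rewrite /= -mulrA 3!(mulrDl _ _ (1 + z T e2 f2)) p1 p3 p4 cyc_sum_z_perp // !addr0 mulr0.
by rewrite mulrnAl => /esym; exact: natmul4_eq0.
Qed.

Lemma x1_sandwich1 T : system T ->
  N T x1 * (1 + z T e1 f1) * N T f1 * N T x1 = N T x1 * (1 + z T x1 f1).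
Proof.
move=> sT; have sw := system_transvs [:: (O, P, M, P); (O, P, O, P)] sT.
have [zx zf] : GRing.comm (z T x1 f1) (N T x1) /\ GRing.comm (z T x1 f1) (N T f1) := z_commute2 sw.
have [zC _ _] : [/\ quat_center (T f1) (T x1) = quat_center (T x1) (T f1), _ & _] :=
  quat_center_plane sw.
have S : N T x1 * N T f1 * N T x1 = N T x1 * (2 - z T x1 f1) := sandwich sw.
have zz : z T x1 f1 * z T x1 f1 = 1 := zK sw.
have [zC1 _ _] := quat_center_plane sT.
have Z : N T f1 * z T f1 x1 = N T f1 * z T f1 e1 :=
  @cyc_sum_quat_center _ (O, P, M, O)
    (system_transvs [:: (P, P, O, O); (O, P, O, O); (O, P, O, O)] sT) isT.
have e : (1 + z T e1 f1) * N T f1 = (1 + z T x1 f1) * N T f1.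
  rewrite !mulrDl; congr (_ + _).
  by rewrite zf -zC Z zC1; case: (z_commute2 sT).
have z1 : N T x1 * (1 + z T x1 f1) = (1 + z T x1 f1) * N T x1.
  by apply: commrD; [exact: commr1|exact/commr_sym].
rewrite -(mulrA (N T x1)) e mulrA z1 -!mulrA (mulrA (N T x1)) S mulrA -z1 -mulrA.
by rewrite (one_add_mul_two_sub zz).
Qed.

(** Sum over the lines of <e1, f1>: [e1] contributes 0, being orthogonal to [x1], and the other
    three contribute equally. *)
Lemma x1_sandwich T : system T ->
  N T x1 * (1 + z T e1 f1) * N T x1 *+ 4 = N T x1 * (1 + z T x1 f1) *+ 3.
Proof.
move=> sT; have [_ z4 z3] := quat_center_plane sT.
have t w := x1_sandwich1 (system_transvs w sT).
have s4 : N T x1 * (1 + z T e1 v4) * N T v4 * N T x1 = N T x1 * (1 + z T x1 v4) := t [:: e1].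
have s3 : N T x1 * (1 + z T e1 v3) * N T v3 * N T x1 = N T x1 * (1 + z T x1 v3) := t [:: e1; e1].
rewrite -mulrnAl -mulrnAr -(sum_plane sT) mulrA 3!(mulrDr (N T x1 * _)) 3!(mulrDl _ _ (N T x1)).
rewrite z4 in s4; rewrite z3 in s3; rewrite x1_sandwich1 // s4 s3.
have -> : N T x1 * (1 + z T e1 f1) * N T e1 * N T x1 = 0.
  rewrite -mulrA.
  have -> : N T e1 * N T x1 = 0; last by rewrite mulr0.
  by rewrite -F_change // cyc_sum_perp.
rewrite !(mulrDr (N T x1)) z_x1 // z_x1 //.
by rewrite add0r [RHS]mulrS mulr2n !addrA.
Qed.

(** A lift of the scalar -1 of Sp_4(3), the same for every choice of two orthogonal hyperbolic
    planes. *)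
Definition z_pair T : G := (quat_center (T e1) (T f1) * quat_center (T e2) (T f2))%g.

Lemma z_pair_commute T p : system T ->
  transvs [:: e1; f1; e1; f1; e1; f1; e2; f2; e2; f2; e2; f2] p = p -> commute (z_pair T) (T p).
Proof.
set w := [:: _, _ & _] => sT pE.
have -> : z_pair T = foldr (fun r g => T r * g)%g 1%g w.
  by rewrite /z_pair quat_center.unlock /= !expgS !expg0 !mulg1 !mulgA.
by rewrite /commute transvs_act // pE.
Qed.

Lemma z_pair_transv T r : system T -> commute (z_pair T) (T r) ->
  z_pair (T \o transv r) = z_pair T.
Proof.
move=> sT c; rewrite /z_pair /= !(systemJV _ _ sT) !quat_centerJ !mulgA mulgVK.
by rewrite -[(T r * _ * _)%g]mulgA -/(z_pair T) -c mulgK.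
Qed.

(** Rewrite [z_pair] with <x1, f1> and its orthogonal plane; next to [N T x1] the involution of the
    latter is -1. *)
Lemma x1_z_pair T : system T -> N T x1 * rho (z_pair T) = - (N T x1 * z T x1 f1).
Proof.
move=> sT; pose w : seq vec := [:: (O, P, M, P); (O, P, O, P)].
have sw := system_transvs w sT.
have e : z_pair (T \o transvs w) = z_pair T.
  have s1 := system_transvs [:: (O, P, M, P)] sT.
  rewrite -(@z_pair_transv T (O, P, M, P)) //; last exact: z_pair_commute.
  rewrite -(@z_pair_transv (T \o transv (O, P, M, P)) (O, P, O, P)) //.
  exact: (z_pair_commute s1).
have zc : GRing.comm (z T x1 f1) (N T x1) := (z_commute2 sw).1.
have := cyc_sum_z_perp sw.
rewrite mulrDr mulr1 => /eqP; rewrite addrC addr_eq0 => /eqP h.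
have : N T x1 * rho (z_pair (T \o transvs w)) = - (N T x1 * z T x1 f1).
  rewrite /z_pair rhoM mulrA.
  have -> : N T x1 * z (T \o transvs w) e1 f1 = z T x1 f1 * N T x1 := esym zc.
  rewrite -mulrA; have -> : N T x1 * z (T \o transvs w) e2 f2 = - N T x1 := h.
  by rewrite mulrN zc.
by rewrite e.
Qed.

(** Put A = N_x1 (1 + z). By [z_perp], the factors 1 + z of <e1, f1> and <e2, f2> add up to 1 -
    [z_pair], so the sum of the two sandwiches reads 12 A = 6 A. *)
Lemma x1_z T : system T -> N T x1 * (1 + z T x1 f1) = 0.
Proof.
move=> sT; have A := x1_sandwich sT.
have B : N T x1 * (1 + z T e2 f2) * N T x1 *+ 4 = N T x1 * (1 + z T x1 f2) *+ 3 :=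
  x1_sandwich (system_transvs swap_planes sT).
have Z : N T x1 * z T x1 f2 = N T x1 * z T x1 f1 :=
  @cyc_sum_quat_center _ (O, P, M, O)
    (system_transvs [:: (O, P, M, P); (O, P, O, P); (O, O, P, P)] sT) isT.
have up := x1_z_pair sT.
have ab : (1 + z T e1 f1) + (1 + z T e2 f2) = 1 - rho (z_pair T).
  have := z_perp sT; rewrite mulrDl mul1r mulrDr mulr1 -rhoM addrA => /eqP.
  rewrite addr_eq0 => /eqP e; rewrite addrAC -addrA; congr (_ + _).
  by rewrite e.
have {}B : N T x1 * (1 + z T e2 f2) * N T x1 *+ 4 = N T x1 * (1 + z T x1 f1) *+ 3.
  by rewrite B !(mulrDr (N T x1)) Z.
have uc : GRing.comm (N T x1) (rho (z_pair T)).
  by apply/commr_sym/cyc_sum_comm/rhoC => //; exact: z_pair_commute.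
have sum : N T x1 * (1 - rho (z_pair T)) *+ 12 = N T x1 * (1 + z T x1 f1) *+ 6.
  rewrite -[6%N]/(3 + 3)%N mulrnDr -{1}A -B -mulrnDl -mulrDl -mulrDr ab.
  have -> : N T x1 * (1 - rho (z_pair T)) * N T x1 = N T x1 * N T x1 * (1 - rho (z_pair T)).
    rewrite -!mulrA; congr (_ * _); apply/esym/commrB => //; exact: commr1.
  by rewrite (cyc_sum_sq rho1 rhoM (system3 sT _)) mulrnAl -mulrnA.
have e : N T x1 * (1 - rho (z_pair T)) = N T x1 * (1 + z T x1 f1).
  by rewrite mulrBr up opprK mulrDr.
apply/natmul2_eq0/natmul3_eq0; rewrite -mulrnA.
by rewrite -[LHS](addrK (N T x1 * (1 + z T x1 f1) *+ 6)) -mulrnDr -{1}e sum subrr.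
Qed.

Lemma z_eq_opp1 T : system T -> z T e1 f1 = - 1.
Proof.
move=> sT; have N0 T' : system T' -> (1 + z T' e1 f1) * N T' e1 = 0.
  move=> sT'; rewrite -[RHS](x1_z (system_transvs [:: (O, P, M, P); (O, P, O, P)] sT')).
  by apply/esym/commrD; [exact: commr1|exact/commr_sym/(z_commute2 sT').1].
have t w := N0 _ (system_transvs w sT).
have n1 : (1 + z T f1 e1) * N T f1 = 0 := t [:: (P, P, O, O); (O, P, O, O); (O, P, O, O)].
have n3 : (1 + z T v3 f1) * N T v3 = 0 := t [:: (O, P, O, O)].
have n4 : (1 + z T v4 f1) * N T v4 = 0 := t [:: (O, P, O, O); (O, P, O, O)].
have [zC _ _] := quat_center_plane sT; have [z3 z4] := quat_center_plane_f1 sT.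
rewrite zC in n1; rewrite z3 in n3; rewrite z4 in n4.
have := sum_plane sT; rewrite 3!(mulrDr (1 + _)) N0 // n1 n3 n4 !addr0 => /esym/natmul4_eq0/eqP.
by rewrite addrC addr_eq0 => /eqP.
Qed.

Lemma rho_braid_eq (g h : G) : (g * h * g = h * g * h)%g ->
  GRing.comm (rho g) (rho h) -> rho g = rho h.
Proof.
move=> /(congr1 rho); rewrite !rhoM => e c; move: e.
rewrite -c -mulrA -c mulrA -[RHS]mulrA -[LHS]mulrA.
move/(congr1 (fun x => rho g^-1%g * x * rho h^-1%g)).
by rewrite !mulrA !rhoVK // !mul1r -!mulrA !rhoKV // !mulr1.
Qed.

Lemma ring_trivial T : system T -> 1 = 0 :> R.
Proof.
move=> sT; have t w := system_braid (system_transvs w sT).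
have xy : rho (T x1) = rho (T y1).
  have : z T e1 f1 * rho (T x1) = rho (T y1) * z T e1 f1.
    by rewrite -!rhoM; congr rho; exact: quat_center_act.
  by rewrite z_eq_opp1 // mulN1r mulrN1 => /oppr_inj.
(* [x2] braids with [y1] and commutes with [x1], and these two now have the same image. *)
have x21 : rho (T x2) = rho (T x1).
  rewrite xy; apply: rho_braid_eq; first exact: t [:: (P, P, P, M); (P, O, O, P); (O, P, O, O)].
  by rewrite -xy; apply: rhoC => //; exact: system_commute.
have x2e1 : rho (T x2) = rho (T e1).
  apply: rho_braid_eq; first exact: t [:: (P, P, O, O); (O, P, O, M); (O, P, O, O)].
  by rewrite x21; apply: rhoC => //; exact: system_commute.
have x2e2 : rho (T x2) = rho (T e2).
  apply: rho_braid_eq; first exact: t [:: (P, M, O, P); (P, O, M, P)].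
  by rewrite x21; apply: rhoC => //; exact: system_commute.
have t3 : rho (T x1) * (rho (T x1) * rho (T x1)) = 1.
  by rewrite -!rhoM -rho1 -(system3 sT x1) !expgS expg0 mulg1.
(* All four factors of [systemL] have the same image t, so t^4 = 1 = t^3. *)
have t1 : rho (T x1) = 1.
  have := congr1 rho (systemL sT); rewrite !rhoM rho1 -x2e1 -x2e2 -xy x21.
  by rewrite -mulrA -mulrA t3 mulr1.
have := F_eq0 sT; rewrite /F !(cyc_sumE rhoM) x21 t1 !mulr1.
have -> : 1 + 1 + 1 = 3 :> R by rewrite -natr1 mulr2n.
by rewrite -natrM mulrnA => /natmul3_eq0/natmul3_eq0.
Qed.

End TransvectionSystem.

(** * The forty conjugates of a generator *)

(** A basis whose consecutive members are non-orthogonal and the others orthogonal: its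
    transvections satisfy the relations of Gamma_5. *)
Definition simple_root (i : nat) : vec := nth e1 [:: e1; f1; x1; f2] i.
Definition refl (i : nat) (p : vec) : vec := transv (simple_root i) p.
Definition act (w : seq nat) (p : vec) : vec := foldr refl p w.

Definition all_vec : seq vec :=
  [seq (a, b) | a <- [seq (a, b) | a <- [seq (a, b) | a <- [:: O; P; M], b <- [:: O; P; M]],
                                   b <- [:: O; P; M]], b <- [:: O; P; M]].
Definition lines : seq vec :=
  [seq p <- all_vec | (normal p == p) && (p != (O, O, O, O))].

(* An entry (i, p) joins the line p to the line refl i p, reached after it. *)
Definition spanning_tree : seq (nat * vec) :=
  [:: (1, (P, O, O, O)); (0, (P, P, O, O)); (1, (P, P, O, O)); (2, (P, P, O, O)); (2, (O, P, O,
   O)); (2, (P, M, O, O)); (2, (O, P, M, O)); (3, (O, P, M, O)); (1, (P, M, P, O)); (2, (P,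
   M, P, O)); (3, (P, M, P, O)); (2, (P, P, M, O)); (3, (P, P, M, O)); (1, (P, M, M, O)); (3,
   (P, M, M, O)); (3, (O, P, M, M)); (3, (P, O, P, O)); (3, (P, P, P, O)); (3, (P, M, P, P));
   (3, (O, P, P, O)); (3, (P, P, M, M)); (3, (P, O, M, O)); (3, (P, M, M, M)); (2, (O, P, M,
   P)); (2, (P, O, P, P)); (3, (P, O, P, P)); (3, (P, P, P, P)); (2, (P, M, P, M)); (3, (O,
   P, P, P)); (2, (P, P, M, P)); (2, (P, O, M, M)); (3, (P, O, M, M)); (1, (P, P, O, P)); (1,
   (P, M, O, M)); (2, (P, O, O, P)); (2, (P, O, M, P)); (0, (P, M, O, P)); (3, (O, O, P, M));
   (0, (P, P, O, M))].

Definition path_table : seq (vec * seq nat) :=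
  foldl (fun tab e => let w := e.1 :: (nth (e1, [::]) tab (index e.2 (unzip1 tab))).2 in
                      rcons tab (act w e1, w))
        [:: (e1, [::])] spanning_tree.
Definition path_to (p : vec) : seq nat :=
  (nth (e1, [::]) path_table (index (normal p) (unzip1 path_table))).2.

Arguments path_to : simpl never.

(** Braid and commutation relations occur in both directions because [scan] deduces edges on the
    left-hand side only. *)
Definition relators : seq (seq nat * seq nat) :=
  [:: ([:: 0; 0; 0], [::]); ([:: 1; 1; 1], [::]); ([:: 2; 2; 2], [::]); ([:: 3; 3; 3], [::]);
      ([:: 0; 1; 0], [:: 1; 0; 1]); ([:: 0; 2], [:: 2; 0]); ([:: 0; 3], [:: 3; 0]);
      ([:: 1; 0; 1], [:: 0; 1; 0]); ([:: 1; 2; 1], [:: 2; 1; 2]); ([:: 1; 3], [:: 3; 1]);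
      ([:: 2; 0], [:: 0; 2]); ([:: 2; 1; 2], [:: 1; 2; 1]); ([:: 2; 3; 2], [:: 3; 2; 3]);
      ([:: 3; 0], [:: 0; 3]); ([:: 3; 1], [:: 1; 3]); ([:: 3; 2; 3], [:: 2; 3; 2])].

(** Tree edges hold by the choice of paths, the edge at [f1] by the braid relation and s_1^3 = 1
    (indices from 0), the others by commutation of generators. *)
Definition base_edges : seq (nat * vec) :=
  spanning_tree ++ (0, f1) ::
  [seq (i, simple_root j) | i <- iota 0 4, j <- [seq j <- iota 0 4 | (i == j) || (1 < (i - j) + (j - i))]]%N.

Fixpoint edges (w : seq nat) (p : vec) : seq (nat * vec) :=
  if w is i :: w' then (i, act w' p) :: edges w' p else [::].

(* As in coset enumeration, an edge (i, p) records the relation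
   s_i t_p s_i^-1 = t_(refl i p) between conjugates of s_0. Both sides of a relator
   carry t_p to the same conjugate, so when all edges along them but one are known,
   the last one follows. *)
Definition scan (K : seq (nat * vec)) (st : nat * nat * vec) : seq (nat * vec) :=
  let: (r, k, p) := st in
  let: (l, r) := nth ([::], [::]) relators r in
  let i := nth 0 l k in let l2 := drop k.+1 l in
  if [&& (k < size l)%N, act l p == act r p,
         all (mem K) (edges (take k l) (act (i :: l2) p)), all (mem K) (edges l2 p)
       & all (mem K) (edges r p)]
  then (i, act l2 p) :: K else K.

(* Each triple consists of a relator, the position of the letter whose edge is
   deduced, and the line at which the relator is read. *)
Definition scans : seq (nat * nat * vec) :=
  [:: (0, 1, (O, P, O, O)); (0, 2, (O, P, O, M)); (1, 0, (P, O, O, O)); (2, 2, (O, O, P, M));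
   (2, 0, (O, P, O, O)); (2, 2, (O, P, P, O)); (2, 1, (O, P, M, O)); (3, 0, (O, P, P, O));
   (3, 0, (O, P, M, O)); (3, 0, (P, O, P, O)); (3, 0, (P, O, M, O)); (3, 0, (P, P, P, O));
   (3, 0, (P, P, M, O)); (3, 0, (P, M, P, O)); (3, 0, (P, M, M, O)); (5, 0, (O, P, O, O));
   (5, 0, (P, P, O, O)); (5, 0, (P, M, O, O)); (5, 0, (P, M, P, O)); (6, 0, (O, P, M, O));
   (6, 0, (O, P, M, M)); (6, 0, (P, O, P, O)); (6, 0, (P, O, P, P)); (6, 1, (P, P, O, O));
   (6, 0, (P, P, P, O)); (6, 0, (P, P, P, P)); (6, 0, (P, P, M, O)); (6, 0, (P, P, M, M));
   (6, 1, (P, M, O, O)); (6, 0, (P, M, P, O)); (6, 0, (P, M, P, P)); (7, 2, (O, P, M, O));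
   (8, 2, (O, P, P, O)); (8, 0, (P, P, O, O)); (9, 0, (O, P, P, O)); (9, 0, (O, P, P, P));
   (9, 0, (O, P, M, O)); (9, 0, (O, P, M, M)); (9, 0, (P, P, M, O)); (9, 0, (P, P, M, M));
   (9, 0, (P, M, P, O)); (9, 0, (P, M, P, P)); (9, 0, (P, M, M, O)); (9, 0, (P, M, M, M));
   (10, 1, (O, P, P, O)); (10, 1, (P, M, M, O)); (11, 0, (O, P, M, O)); (11, 0, (O, P, M,
   P)); (11, 2, (P, M, P, P)); (12, 2, (O, P, P, M)); (12, 1, (P, O, M, P)); (12, 1, (P, O,
   M, M)); (12, 0, (P, P, O, O)); (12, 2, (P, P, P, M)); (12, 0, (P, M, O, O)); (12, 0, (P,
   M, P, O)); (12, 2, (P, M, M, P)); (12, 2, (P, M, M, M)); (13, 1, (O, P, P, M)); (13, 1,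
   (P, M, M, P)); (13, 1, (P, M, M, M)); (15, 1, (O, P, P, O)); (15, 0, (O, P, M, M)); (15,
   0, (P, P, M, M)); (15, 0, (P, M, P, P)); (0, 2, (O, P, P, P)); (1, 2, (P, O, M, O)); (1,
   2, (P, O, M, P)); (1, 2, (P, O, M, M)); (2, 2, (O, P, O, P)); (2, 0, (O, P, P, P)); (2, 1,
   (O, P, M, P)); (3, 2, (O, O, P, O)); (4, 0, (O, P, P, O)); (4, 0, (O, P, P, P)); (4, 0,
   (O, P, P, M)); (4, 1, (P, M, M, O)); (4, 1, (P, M, M, P)); (4, 1, (P, M, M, M)); (5, 1,
   (O, P, O, M)); (5, 0, (O, P, M, P)); (5, 0, (P, O, M, P)); (5, 0, (P, O, M, M)); (5, 1,
   (P, P, O, M)); (5, 0, (P, P, M, P)); (5, 0, (P, M, P, M)); (6, 0, (O, O, P, P)); (6, 0,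
   (O, O, P, M)); (7, 0, (P, M, P, O)); (7, 0, (P, M, P, P)); (7, 0, (P, M, P, M)); (8, 2,
   (O, O, P, M)); (8, 2, (O, P, O, P)); (8, 2, (P, O, O, P)); (8, 0, (P, P, O, P)); (8, 1,
   (P, M, O, M)); (8, 1, (P, M, P, M)); (8, 0, (P, M, M, P)); (9, 0, (O, O, P, M)); (9, 1,
   (P, M, O, P)); (10, 1, (P, O, O, M)); (11, 0, (P, O, P, P)); (11, 0, (P, O, M, P)); (12,
   1, (O, O, P, P)); (12, 0, (P, O, O, P)); (13, 0, (P, M, O, P)); (4, 1, (P, M, O, P)); (6,
   1, (O, P, O, M)); (7, 2, (O, P, O, M)); (7, 0, (P, M, O, M))].

Definition closed_edges : seq (nat * vec) := foldl scan base_edges scans.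

(** * Finite checks on lines and vectors *)

Lemma closed_edgesP i p : (i < 4)%N -> p \in lines -> (i, p) \in closed_edges.
Proof.
move=> i4 pl; have H : all (mem closed_edges) [seq (i, p) | i <- iota 0 4, p <- lines].
  by vm_compute.
have allS (K l : seq (nat * vec)) : all (mem K) l -> {subset l <= K} by move/allP.
have i4' : i \in iota 0 4 by rewrite mem_iota.
have m : (i, p) \in [seq (i, p) | i <- iota 0 4, p <- lines] := allpairs_f pair i4' pl.
exact: allS H _ m.
Qed.

Lemma spanning_treeP : all (fun e => path_to (refl e.1 e.2) == e.1 :: path_to e.2) spanning_tree.
Proof. by vm_compute. Qed.

Lemma spanning_tree_path e : e \in spanning_tree ->
  path_to (refl e.1 e.2) = e.1 :: path_to e.2.
Proof. by move=> eT; apply/eqP; move: e eT; apply/allP; exact: spanning_treeP. Qed.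

Lemma spanning_tree_neq0 e : e \in spanning_tree ->
  (normal e.2 != (O, O, O, O)) && (normal (refl e.1 e.2) != (O, O, O, O)).
Proof. by move: e; apply/allP; vm_compute. Qed.

Lemma mem_all_vec p : p \in all_vec.
Proof. by case: p => [[[[[]|] [[]|]] [[]|]] [[]|]]. Qed.

Lemma normal_cases p : normal p = (O, O, O, O) \/ normal p \in lines.
Proof.
have := @allP _ (fun p => (normal p == (O, O, O, O)) || (normal p \in lines)) all_vec.
by move=> /(_ _ p (mem_all_vec p)); move=> H; case/orP: (H isT) => [/eqP|]; [left|right].
Qed.

Lemma transv_normal p q : transv (normal p) (normal q) = transv p q.
Proof.
have : all (fun p => all (fun q => transv (normal p) (normal q) == transv p q) all_vec) all_vec.
  by vm_compute.
by move=> /allP/(_ p (mem_all_vec p))/allP/(_ q (mem_all_vec q))/eqP.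
Qed.

Lemma normalK p : normal (normal p) = normal p.
Proof.
apply/eqP; have : all (fun q => normal (normal q) == normal q) all_vec by vm_compute.
by move=> /allP/(_ p (mem_all_vec p)).
Qed.

Lemma transv_vec0 p : transv p (O, O, O, O) = (O, O, O, O).
Proof.
apply/eqP; have : all (fun q => transv q (O, O, O, O) == (O, O, O, O)) all_vec by vm_compute.
by move=> /allP/(_ p (mem_all_vec p)).
Qed.

Lemma transv_0vec p : transv (O, O, O, O) p = normal p.
Proof.
apply/eqP; have : all (fun q => transv (O, O, O, O) q == normal q) all_vec by vm_compute.
by move=> /allP/(_ p (mem_all_vec p)).
Qed.

Lemma transv_normalr p q : transv p (normal q) = transv p q.
Proof. by rewrite -transv_normal normalK transv_normal. Qed.

Lemma transv_normall p q : transv (normal p) q = transv p q.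
Proof. by rewrite -transv_normal normalK transv_normal. Qed.

Lemma transv_neq0 p q : normal q != (O, O, O, O) -> normal (transv p q) != (O, O, O, O).
Proof.
have : all (fun p => all (fun q => (normal q != (O, O, O, O)) ==>
    (normal (transv p q) != (O, O, O, O))) all_vec) all_vec by vm_compute.
by move=> /allP/(_ p (mem_all_vec p))/allP/(_ q (mem_all_vec q))/implyP.
Qed.

Lemma path_to_lt4 p : p \in lines -> all (fun i => i < 4)%N (path_to p).
Proof.
have : all (fun p => all (fun i => i < 4)%N (path_to p)) lines by vm_compute.
by move=> /allP; exact.
Qed.

(** Inverses are written as squares, the generators having order 3. *)
Definition inv_word (w : seq nat) : seq nat := flatten [seq [:: i; i] | i <- rev w].

Lemma transv_path p q : p \in lines ->
  act (path_to p ++ 0 :: inv_word (path_to p)) q = transv p q.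
Proof.
have : all (fun p => let w := path_to p ++ 0 :: inv_word (path_to p) in
                     all (fun q => act w q == transv p q) all_vec) lines by vm_compute.
by move=> /allP H /H/allP/(_ q (mem_all_vec q))/eqP.
Qed.

(** * Realising the lines in the group *)

Definition eval (G : groupType) (s : nat -> G) (w : seq nat) : G :=
  foldr (fun i g => (s i * g)%g) 1%g w.

(** Defined through one chosen path per line; that the generators permute these elements is what the
    closure of the edges provides. *)
HB.lock Definition root_elt (G : groupType) (s : nat -> G) (p : vec) : G :=
  if normal p == (O, O, O, O) then 1%g
  else (eval s (path_to p) * s 0 * (eval s (path_to p))^-1)%g.

Section RootElements.
Variables (G : groupType) (s : nat -> G).
Local Open Scope group_scope.

Local Notation eval := (eval s).
Local Notation root_elt := (root_elt s).

Hypothesis evalP : forall l r, (l, r) \in relators -> eval l = eval r.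

Let known (e : nat * vec) := s e.1 * root_elt e.2 = root_elt (refl e.1 e.2) * s e.1.

Lemma act_cat u v p : act (u ++ v) p = act u (act v p).
Proof. exact: foldr_cat. Qed.

Lemma eval_cons i w : eval (i :: w) = s i * eval w.
Proof. by []. Qed.

Lemma eval_cat u v : eval (u ++ v) = eval u * eval v.
Proof. by elim: u => [|i u IH] /=; rewrite ?mul1g // IH mulgA. Qed.

Let known_edges w p : {in edges w p, forall e, known e} ->
  eval w * root_elt p = root_elt (act w p) * eval w.
Proof.
elim: w => [|i w IH] /= K; first by rewrite mul1g mulg1.
rewrite -mulgA IH => [|e ew]; last by apply: K; rewrite inE ew orbT.
by rewrite !mulgA; congr (_ * _); exact: (K _ (mem_head _ _)).
Qed.

Let known_scan K st : {in K, forall e, known e} -> {in scan K st, forall e, known e}.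
Proof.
move: st => [[r k] p] KP; rewrite /scan; have := @mem_nth _ ([::], [::]) relators r.
case: (ltnP r (size relators)) => [_|rs _]; last by rewrite nth_default.
case: (nth _ _ _) => [l l'] /(_ isT) /evalP ll.
case: ifP => // /and5P[kl /eqP e a1 a2 a3] e'; rewrite inE => /orP[/eqP->|]; last exact: KP.
have KA w q : all (mem K) (edges w q) -> {in edges w q, forall e, known e}.
  by move=> /allP wq x /wq; exact: KP.
have el := cat_take_drop k l; rewrite (drop_nth 0%N kl) in el.
move: el a1 a2 e ll; move: (take k l) (nth _ l k) (drop _ l) => l1 i l2 <- a1 a2 e ll.
have p3 := known_edges (KA _ _ a3); have p2 := known_edges (KA _ _ a2).
have p1 := known_edges (KA _ _ a1).
rewrite -ll -e act_cat eval_cat /= in p3.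
apply: (mulgI (eval l1)); apply: (mulIg (eval l2)); rewrite /=.
have -> : eval l1 * (s i * root_elt (act l2 p)) * eval l2
    = eval l1 * s i * (root_elt (act l2 p) * eval l2) by rewrite !mulgA.
rewrite -p2.
have -> : eval l1 * (root_elt (refl i (act l2 p)) * s i) * eval l2
    = eval l1 * root_elt (refl i (act l2 p)) * (s i * eval l2) by rewrite !mulgA.
by rewrite p1 -[RHS]mulgA -p3 !mulgA.
Qed.

Lemma cube_gen i : (i < 4)%N -> s i * s i * s i = 1.
Proof.
have c r : r \in relators -> eval r.1 = eval r.2 by case: r => l r; exact: evalP.
have e j : ([:: j; j; j], [::]) \in relators -> s j * s j * s j = 1.
  by move/evalP; rewrite /= mulg1 !mulgA.
by case: i => [|[|[|[|//]]]] _; apply: e.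
Qed.

Let root_elt_path p w : normal p != (O, O, O, O) -> path_to p = w ->
  root_elt p = eval w * s 0 * (eval w)^-1.
Proof. by move=> /negPf n0 pw; rewrite root_elt.unlock n0 pw. Qed.

Let spanning_tree_known e : e \in spanning_tree -> known e.
Proof.
move=> eT; have pE := spanning_tree_path eT.
have /andP[n1 n2] := spanning_tree_neq0 eT.
rewrite /known (root_elt_path n1 erefl) (root_elt_path n2 pE).
by rewrite eval_cons invgM !mulgA mulgVK.
Qed.

Lemma braid_gen i : (i < 3)%N -> s i * s i.+1 * s i = s i.+1 * s i * s i.+1.
Proof.
have e j k : ([:: j; k; j], [:: k; j; k]) \in relators -> s j * s k * s j = s k * s j * s k.
  by move/evalP; rewrite /= !mulg1 !mulgA.
by case: i => [|[|[|//]]] _; apply: e.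
Qed.

Lemma commute_gen i j : (i < 4)%N -> (j < 4)%N -> (i == j) || (1 < (i - j) + (j - i))%N ->
  s i * s j = s j * s i.
Proof.
have e k l : ([:: k; l], [:: l; k]) \in relators -> s k * s l = s l * s k.
  by move/evalP; rewrite /= !mulg1.
by case: i => [|[|[|[|//]]]] _; case: j => [|[|[|[|//]]]] _ //= _; exact: e.
Qed.

Let braid_conj i : (i < 3)%N -> s i * s i.+1 * s i * (s i * s i.+1)^-1 = s i.+1.
Proof. by move/braid_gen->; rewrite -[s i.+1 * _ * _]mulgA mulgK. Qed.

Lemma root_elt_simple i : (i < 4)%N -> root_elt (simple_root i) = s i.
Proof.
have conj u v g : eval (u ++ v) * g * (eval (u ++ v))^-1
    = eval u * (eval v * g * (eval v)^-1) * (eval u)^-1.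
  by rewrite eval_cat invgM !mulgA.
have r1 : eval [:: 0; 1]%N * s 0 * (eval [:: 0; 1]%N)^-1 = s 1 by rewrite /= mulg1 braid_conj.
have r2 : eval [:: 1; 2; 0; 1]%N * s 0 * (eval [:: 1; 2; 0; 1]%N)^-1 = s 2.
  by rewrite (conj [:: 1; 2]%N [:: 0; 1]%N) r1 /= mulg1 braid_conj.
have r3 : eval [:: 2; 3; 1; 2; 0; 1]%N * s 0 * (eval [:: 2; 3; 1; 2; 0; 1]%N)^-1 = s 3.
  by rewrite (conj [:: 2; 3]%N [:: 1; 2; 0; 1]%N) r2 /= mulg1 braid_conj.
case: i => [|[|[|[|//]]]] _.
- have p0 : path_to e1 = [::] by vm_compute.
  by rewrite (root_elt_path _ p0) //= mul1g invg1 mulg1.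
- have p1 : path_to f1 = [:: 0; 1]%N by vm_compute.
  by rewrite (root_elt_path _ p1).
- have p2 : path_to x1 = [:: 1; 2; 0; 1]%N by vm_compute.
  by rewrite (root_elt_path _ p2).
- have p3 : path_to f2 = [:: 2; 3; 1; 2; 0; 1]%N by vm_compute.
  by rewrite (root_elt_path _ p3).
Qed.

Let base_edges_known : {in base_edges, forall e, known e}.
Proof.
move=> e; rewrite mem_cat => /orP[/spanning_tree_known//|].
rewrite inE => /orP[/eqP->|].
  rewrite /known /= (root_elt_simple (isT : (1 < 4)%N)).
  have p11 : path_to (refl 0 f1) = [:: 1; 1]%N by vm_compute.
  rewrite (root_elt_path _ p11) //= mulg1.
  have s3 : s 1%N * s 1%N * s 1%N = 1 by exact: cube_gen.
  have -> : (s 1%N * s 1%N)^-1 = s 1%N by apply: (mulgI (s 1%N * s 1%N)); rewrite mulgV s3.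
  by rewrite -!mulgA [s 0%N * (_ * _)]mulgA braid_gen // !mulgA s3 mul1g.
have chk : all (fun e => (e.1 < 4)%N && has (fun j => [&& e.2 == simple_root j,
    (e.1 == j) || (1 < (e.1 - j) + (j - e.1))%N & refl e.1 e.2 == e.2]) (iota 0 4))
  [seq (i, simple_root j) | i <- iota 0 4,
     j <- [seq j <- iota 0 4 | (i == j) || (1 < (i - j) + (j - i))]]%N by vm_compute.
move=> /(allP chk)/andP[i4 /hasP[j]]; rewrite mem_iota => /= j4 /and3P[/eqP ej ij /eqP re].
by rewrite /known re ej root_elt_simple // commute_gen.
Qed.

Lemma root_elt_normal p : root_elt (normal p) = root_elt p.
Proof. by rewrite !root_elt.unlock /path_to normalK. Qed.

Lemma root_elt0 p : normal p = (O, O, O, O) -> root_elt p = 1.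
Proof. by rewrite root_elt.unlock => ->. Qed.

Lemma gen_root_elt i p : (i < 4)%N -> s i * root_elt p = root_elt (refl i p) * s i.
Proof.
move=> i4; rewrite -(root_elt_normal p) /refl -transv_normalr.
case: (normal_cases p) => [->|pl]; first by rewrite transv_vec0 root_elt0 // mul1g mulg1.
have scansP sts K : {in K, forall e, known e} -> {in foldl scan K sts, forall e, known e}.
  by elim: sts K => [//|st sts IH] K KP; exact/IH/known_scan.
have k : known (i, normal p); last exact: k.
exact: (scansP scans base_edges base_edges_known _ (closed_edgesP i4 pl)).
Qed.

Lemma eval_root_elt w p : all (fun i => i < 4)%N w ->
  eval w * root_elt p = root_elt (act w p) * eval w.
Proof.
elim: w => [|i w IH] /=; first by rewrite mul1g mulg1.
by case/andP=> i4 w4; rewrite -mulgA IH // !mulgA gen_root_elt.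
Qed.

Lemma eval_inv_word w : all (fun i => i < 4)%N w -> eval (inv_word w) = (eval w)^-1.
Proof.
elim: w => [|i w IH] /=; first by rewrite invg1.
case/andP=> i4 w4; rewrite /inv_word rev_cons map_rcons flatten_rcons eval_cat IH // invgM.
congr (_ * _); rewrite /= mulg1; apply: (mulgI (s i)).
by rewrite mulgV mulgA cube_gen.
Qed.

(** [root_elt p] is the value of a word in the generators that acts on lines as [transv p]. *)
Lemma root_eltJ p q : root_elt p * root_elt q = root_elt (transv p q) * root_elt p.
Proof.
case: (normal_cases p) => [p0|pl].
  by rewrite -transv_normall p0 transv_0vec root_elt_normal (root_elt0 p0) mul1g mulg1.
have w4 := path_to_lt4 pl; have := transv_path q pl; rewrite transv_normall.
rewrite -[root_elt p]root_elt_normal.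
have n0 : normal (normal p) != (O, O, O, O).
  by move: pl; rewrite mem_filter => /andP[/andP[/eqP-> ]].
rewrite (root_elt_path n0 erefl); move: (path_to _) w4 => w w4 <-.
rewrite -(eval_inv_word w4).
have -> : eval w * s 0 * eval (inv_word w) = eval (w ++ 0%N :: inv_word w).
  by rewrite eval_cat eval_cons mulgA.
apply: eval_root_elt; rewrite all_cat w4 /=.
by rewrite /inv_word; elim: w w4 => //= i w IH /andP[i4 w4];
  rewrite rev_cons map_rcons flatten_rcons all_cat IH //= i4.
Qed.

Lemma root_elt_cube p : root_elt p ^+ 3 = 1.
Proof.
rewrite root_elt.unlock; case: ifP => _; first by rewrite expg1n.
move: (eval _) => g; rewrite !expgS expg0 !mulg1 !mulgA !mulgVK.
have -> : g * s 0 * s 0 * s 0 = g * (s 0 * s 0 * s 0) by rewrite !mulgA.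
by rewrite cube_gen // mulg1 mulgV.
Qed.

Lemma centralise_root_elt g p : (forall i, (i < 4)%N -> commute g (s i)) -> commute g (root_elt p).
Proof.
move=> c; case: (normal_cases p) => [p0|pl]; first by rewrite root_elt0 //; exact: commute1.
have cw w : all (fun i => i < 4)%N w -> commute g (eval w).
  elim: w => [|i w IH] /=; first by move=> _; exact: commute1.
  by case/andP=> i4 w4; apply: commuteM; [exact: c|exact: IH].
rewrite -root_elt_normal root_elt.unlock; case: ifP => _; first exact: commute1.
have := cw _ (path_to_lt4 pl); move: (eval _) => h gh.
by apply/commuteM/commuteV => //; apply/commuteM/c.
Qed.

End RootElements.

(** * Removing the central factor *)

Section HeisenbergCenter.
Local Open Scope group_scope.
Variables (G : groupType) (a0 a1 a2 b0 b1 b2 : G).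
Hypotheses (a01 : commute a0 a1) (a02 : commute a0 a2) (a12 : commute a1 a2).
Hypotheses (b01 : commute b0 b1) (a13 : a1 ^+ 3 = 1) (b03 : b0 ^+ 3 = 1).
Let x := a0^-1 * a1.
Let y := b0^-1 * b1.
Hypotheses (ya0 : y * a0 = a1 * y) (ya1 : y * a1 = a2 * y).
Hypotheses (xb1 : x * b1 = b0 * x) (xb0 : x * b0 = b2 * x).

Let swapV (g h k : G) : g * h = k * g -> g * h^-1 = k^-1 * g.
Proof. by move=> e; apply: (mulIg h); rewrite mulgVK -mulgA e mulKg. Qed.

(* Both sides are the commutator of x and y. *)
Lemma heisenberg_center : a0 * a1 * a2 = b0 * b1 * b2.
Proof.
have yx : y * x = a1^-1 * a2 * y by rewrite /x mulgA (swapV ya0) -[_ * y * a1]mulgA ya1 mulgA.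
have xy : x * y = b2^-1 * b0 * x by rewrite [in LHS]/y mulgA (swapV xb0) -[_ * x * b1]mulgA xb1 mulgA.
have ea : a1^-1 * a1^-1 = a1 by rewrite -cube_inv ?invgK // expVgn a13 invg1.
have eb : b0^-1 * b0^-1 = b0 by rewrite -cube_inv ?invgK // expVgn b03 invg1.
transitivity (y * x * y^-1 * x^-1).
  rewrite yx mulgK /x invgM invgK !mulgA.
  rewrite -[a1^-1 * a2 * a1^-1]mulgA (swapV (esym a12)) mulgA ea.
  by rewrite -[RHS]mulgA -a02 mulgA a01.
have commE (g h : G) : h * g * h^-1 * g^-1 = h * (g * h * g^-1)^-1.
  by rewrite !invgM invgK !mulgA.
have b10 : b1 * b0^-1 = b0^-1 * b1 by apply/swapV/esym.
by rewrite commE xy mulgK invgM invgK /y mulgA -[b0^-1 * _ * _]mulgA b10 mulgA eb.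
Qed.

End HeisenbergCenter.

(** The other words have degree 0 in [s], [t], and the involution has degree 6, a multiple of 3. *)
Lemma quat_sum_central (G : groupType) (R : pzRingType) (rho : G -> R) (s t c : G) :
  commute c s -> commute c t -> (c ^+ 3 = 1)%g ->
  quat_sum rho (s * c)%g (t * c)%g = quat_sum rho s t.
Proof.
move=> cs ct c3; have sct : (s * c * (t * c)^-1 = s * t^-1)%g by rewrite invgM mulgA mulgK.
have ctV : commute c^-1%g (t^-1 * s)%g.
  by apply/commute_sym/commuteV/commute_sym/commuteM/cs/commuteV.
rewrite /quat_sum sct; congr (_ * (_ + rho _ + rho _)); last first.
- by rewrite invgM -mulgA [(t^-1 * (s * c))%g]mulgA mulgA ctV mulgVK.
- have cx : commute c (s * t^-1)%g by apply/commuteM/commuteV.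
  by rewrite invgM -[(s * c * _)%g]mulgA cx !mulgA mulgK.
congr (_ + rho _); rewrite quat_center.unlock.
have -> : (s * c * (t * c) = s * t * (c * c))%g by rewrite -mulgA [(c * (t * c))%g]mulgA ct !mulgA.
have cst : commute (s * t)%g c by apply/commute_sym/commuteM.
by rewrite (expgMn _ (commuteM cst cst)) (expgMn _ (erefl : commute c c)) c3 !mulg1.
Qed.

Section SystemOfBraid.
Variables (G : groupType) (R : pzRingType) (rho : G -> R) (s : nat -> G).
Hypotheses (rho1 : rho 1%g = 1) (rhoM : {morph rho : x y / (x * y)%g >-> x * y}).
Hypothesis evalP : forall l r, (l, r) \in relators -> eval s l = eval s r.
Hypothesis qs : quat_sum rho (s 0) (s 1) = 0.
Local Open Scope group_scope.
Local Notation S := (root_elt s).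

(* The central element by which Gamma_5 differs from Sp_4(3), written with the lines
   of <e1, e2>; centerE1 and centerE2 use <e2, f1> and <e1, f2> instead, which shows
   that it also commutes with the generators of lines f1 and f2. *)
Let center : G := S e1 * S e2 * S x1 * S y1.

Let SJ p q : S p * S q = S (transv p q) * S p. Proof. exact: root_eltJ. Qed.
Let SC p q : transv p q = q -> commute (S p) (S q).
Proof. by move=> pq; rewrite /commute SJ pq. Qed.
Let S3 p : S p ^+ 3 = 1. Proof. exact: root_elt_cube. Qed.

Let centerE1 : center = S e2 * (S f1 * S (O, P, P, O) * S (O, P, M, O)).
Proof.
rewrite /center (@SC e1 e2 erefl) -!mulgA; congr (_ * _); rewrite !mulgA.
apply: heisenberg_center; rewrite ?S3 //; try exact: SC.
- exact: mulVg_swap (SJ (O, P, P, O) e1) (SJ f1 x1).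
- exact: mulVg_swap (SJ (O, P, P, O) x1) (SJ f1 y1).
- exact: mulVg_swap (SJ x1 (O, P, P, O)) (SJ e1 f1).
- exact: mulVg_swap (SJ x1 f1) (SJ e1 (O, P, M, O)).
Qed.

Let centerE2 : center = S e1 * (S f2 * S (P, O, O, P) * S (P, O, O, M)).
Proof.
rewrite /center -!mulgA; congr (_ * _); rewrite !mulgA.
apply: heisenberg_center; rewrite ?S3 //; try exact: SC.
- exact: mulVg_swap (SJ (P, O, O, P) e2) (SJ f2 x1).
- exact: mulVg_swap (SJ (P, O, O, P) x1) (SJ f2 y1).
- exact: mulVg_swap (SJ x1 (P, O, O, P)) (SJ e2 f2).
- exact: mulVg_swap (SJ x1 f2) (SJ e2 (P, O, O, M)).
Qed.

Let center_gen i : (i < 4)%N -> commute center (s i).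
Proof.
move=> i4; rewrite -(root_elt_simple evalP i4); apply: commute_sym.
case: i i4 => [|[|[|[|//]]]] _ /=.
- by do 3?apply: commuteM; exact: SC.
- by rewrite centerE1; do 3?apply: commuteM; exact: SC.
- by do 3?apply: commuteM; exact: SC.
- by rewrite centerE2; do 3?apply: commuteM; exact: SC.
Qed.

Let centerC p : commute center (S p).
Proof. by apply: centralise_root_elt => i; exact: center_gen. Qed.

Let center3 : center ^+ 3 = 1.
Proof.
have c p q : transv p q = q -> commute (S p) (S q) := @SC p q.
rewrite /center !expgMn ?S3 ?mulg1 //; try exact: SC.
  by apply/commute_sym/commuteM; exact: SC.
by apply/commute_sym; do 2?apply: commuteM; exact: SC.
Qed.

(** With four factors, the product over an isotropic plane becomes c c^-4 = c^-3 = 1 for c =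
    [center]. *)
Definition transvection_elt (p : vec) : G :=
  if normal p == (O, O, O, O) then 1 else S p * center^-1.

Lemma system_transvection_elt : system rho transvection_elt.
Proof.
have tE p : normal p != (O, O, O, O) -> transvection_elt p = S p * center^-1.
  by rewrite /transvection_elt => /negPf->.
have cV : center^-1 ^+ 3 = 1 by rewrite expVgn center3 invg1.
have CV p : commute center^-1 (S p) by apply/commute_sym/commuteV/commute_sym.
split.
- move=> p; rewrite /transvection_elt; case: ifP => _; first by rewrite expg1n.
  by rewrite expgMn ?S3 ?mul1g //; exact/commute_sym.
- move=> p q; case: (eqVneq (normal p) (O, O, O, O)) => [p0|p0].
    have -> : transvection_elt p = 1 by rewrite /transvection_elt p0.
    by rewrite mul1g mulg1 /transvection_elt -transv_normall p0 transv_0vec normalK root_elt_normal.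
  rewrite (tE p) //; case: (eqVneq (normal q) (O, O, O, O)) => [q0|q0].
    have -> : transvection_elt q = 1 by rewrite /transvection_elt q0.
    rewrite -transv_normalr q0 transv_vec0.
    by rewrite [transvection_elt _]/(1) mul1g mulg1.
  have swap g p' q' : S p' * g * (S q' * g) = S p' * (g * S q') * g by rewrite !mulgA.
  by rewrite !tE ?transv_neq0 // !swap !CV !mulgA SJ.
- rewrite !tE //; move: CV cV (erefl center); rewrite {3}/center.
  move: (center^-1) (mulgV center) => c cc CV c3 e.
  have mv g p : g * c * S p = g * S p * c by rewrite -!mulgA CV.
  by rewrite !mulgA !mv e cc mul1g -[RHS]c3 !expgS expg0 mulg1 !mulgA.
- have s0 : S e1 = s 0 := root_elt_simple evalP (isT : (0 < 4)%N).
  have s1 : S f1 = s 1%N := root_elt_simple evalP (isT : (1 < 4)%N).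
  by rewrite !tE // quat_sum_central // s0 s1 qs.
Qed.

End SystemOfBraid.

(** * Enumeration of the quaternion subgroup *)

Section QuaternionSubgroup.
Local Open Scope group_scope.

Notation plane := ('Z_3 * 'Z_3)%type.

(* Gamma_3 acts on F_3^2 by these shears, which separates the elements of Q. *)
Definition shear1 (u : plane) : plane := (u.1 + u.2, u.2)%R.
Definition shear2 (u : plane) : plane := (u.1, u.2 - u.1)%R.

Lemma shear1_inj : injective shear1.
Proof. move=> [a b] [c d] e; have := congr1 fst e; have := congr1 snd e.
by rewrite /= => -> /addIr->. Qed.

Lemma shear2_inj : injective shear2.
Proof. move=> [a b] [c d] e; have := congr1 snd e; have := congr1 fst e.
by rewrite /= => -> /addIr->. Qed.

Definition shear (i : 'I_3.-1) : {perm plane} :=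
  if i == ord0 then perm shear1_inj else perm shear2_inj.

Lemma shear_respects : respects (@gamma_rel 3) shear.
Proof.
have all9 (f g : {perm plane}) :
  all (fun u => f u == g u) [seq (a, b) | a <- [:: 0; 1; 2]%R, b <- [:: 0; 1; 2]%R] -> f = g.
  move=> /allP fg; apply/permP => -[a b]; apply/eqP/fg.
  by case: a => [[|[|[|]]]] //= ?; case: b => [[|[|[|]]]].
move=> u v [i j ij|i j ij|i]; rewrite /word_eval !big_cons !big_nil /= !mulg1.
- by case: i j ij => [[|[|]]//] ? [[|[|]]//].
- have i0 : i = ord0 by apply/val_inj; case: i j ij => [[|[|]]//] ? [[|[|]]//].
  have j1 : j = ord_max by apply/val_inj; rewrite [LHS]ij i0.
  by apply: all9; rewrite i0 j1 /shear /= !permM !permE.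
- by apply: all9; rewrite /shear; case: ifP => _; rewrite /= !permM !permE.
Qed.

Let phi : Gamma 3 -> {perm plane} := pres_lift shear_respects.
Local Notation a := (gamma_gen (ord0 : 'I_3.-1)).
Local Notation b := (gamma_gen (ord_max : 'I_3.-1)).

Let a3 : a ^+ 3 = 1 :> Gamma 3.
Proof. by rewrite !expgS expg0 mulg1 mulgA; exact: gamma_cube. Qed.
Let b3 : b ^+ 3 = 1 :> Gamma 3.
Proof. by rewrite !expgS expg0 mulg1 mulgA; exact: gamma_cube. Qed.
Let ab : a * b * a = b * a * b :> Gamma 3.
Proof. exact: gamma_braid. Qed.

Definition quat_list : seq (Gamma 3) :=
  let x := a * b^-1 in let y := a * x * a^-1 in
  [:: 1; x; x * x; x * (x * x); y; y * x; y * (x * x); y * (x * (x * x))].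

(** The quaternion group is regular on the eight nonzero vectors of F_3^2, so the images of (1, 0)
    separate its elements. *)
Lemma uniq_quat_list : uniq quat_list.
Proof.
have fM g h u : phi (g * h) u = phi h (phi g u) by rewrite /phi gmulfM permM.
have fa u : phi a u = shear1 u by rewrite /phi pres_lift_gen /shear /= permE.
have fb u : phi b u = shear2 u by rewrite /phi pres_lift_gen /shear /= permE.
apply: (@map_uniq _ _ (fun g => phi g (1, 0)%R)).
rewrite /quat_list (cube_inv b3) (cube_inv a3) /= !fM !fa !fb.
have -> : phi 1 (1, 0)%R = (1, 0)%R by rewrite /phi gmulf1 perm1.
by vm_compute.
Qed.

Lemma Q_quat_list : Q = [set` quat_list]%classic.
Proof.
pose x := a * b^-1; pose y := a * x * a^-1.
have dM g h : Gamma_degree (g * h) = Gamma_degree g * Gamma_degree h by rewrite gmulfM.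
have dV g : Gamma_degree g^-1 = (Gamma_degree g)^-1 by rewrite gmulfV.
have dx : Gamma_degree x = 1 by rewrite /x dM dV !Gamma_degree_gen mulgV.
have dy : Gamma_degree y = 1 by rewrite /y 2!dM dV dx mulg1 mulgV.
apply/seteqP; split=> g /=; last first.
  rewrite /Q /= !inE.
  by do ![case/orP] => /eqP->; rewrite ?(gmulf1, dM, dV, Gamma_degree_gen, mulgV, mulg1).
rewrite /Q /= => dg.
have nf := @quaternion_normal_form _ a b _ _ _ (gamma_cube _) (gamma_cube _) ab erefl erefl erefl.
have [t gE] : exists t : bool * 'I_4 * 'I_3, g = y ^+ t.1.1 * x ^+ t.1.2 * a ^+ t.2.
  rewrite -[g]pres_classK; move: (repr g) => wd.
  have [t tE] := nf [seq (l.1 == ord_max, l.2) | l <- wd].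
  exists t; rewrite -tE big_map.
  have -> : pres_class (@gamma_rel 3) wd = word_eval (@gamma_gen 3) wd.
    by rewrite (word_eval_gen _ id) map_id_in // => -[].
  apply: eq_bigr => -[i c] _ /=.
  have -> : @gamma_gen 3 i = if i == ord_max then b else a.
    by case: eqP => [->//|/eqP ne]; congr gamma_gen; apply: val_inj;
       case: i ne => -[|[|//]].
  by [].
(* [x] and [y] have degree 0, so the degree is the exponent of [a] modulo 3. *)
have t0 : t.2 = 0%N :> nat.
  have dX (h : Gamma 3) u : Gamma_degree (h ^+ u) = Gamma_degree h ^+ u.
    by elim: u => [|u IH]; rewrite ?gmulf1 // !expgS dM IH.
  move: dg; rewrite gE 2!dM !dX dx dy !expg1n !mul1g Gamma_degree_gen.
  by case: t.2 => [[|[|[|//]]]].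
rewrite gE t0 expg0 mulg1 /quat_list -/x -/y !inE.
case: t {gE t0} => [[[] [[|[|[|[|//]]]] ?]] ?]; by rewrite /= ?expgS ?expg0 ?mulg1 ?mul1g !eqxx ?orbT.
Qed.

End QuaternionSubgroup.

(** * Conclusion *)

(** Since X X = z and Y X = z W, the list reads 1, X, z, z X, Y, z W, z Y, W. *)
Lemma quat_sum_quat_list (G : groupType) (R : pzRingType) (rho : G -> R) (f : Gamma 3 -> G)
    (s t : G) :
  rho 1%g = 1 -> {morph rho : x y / (x * y)%g >-> x * y} ->
  f 1%g = 1%g -> {morph f : x y / (x * y)%g} -> {morph f : x / (x^-1)%g} ->
  f (gamma_gen (ord0 : 'I_3.-1)) = s -> f (gamma_gen (ord_max : 'I_3.-1)) = t ->
  \sum_(g <- quat_list) rho (f g) = quat_sum rho s t.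
Proof.
move=> rho1 rhoM f1 fM fV fs ft.
have s3 : (s ^+ 3 = 1)%g.
  by rewrite -fs !expgS expg0 mulg1 -!fM mulgA gamma_cube f1.
have t3 : (t ^+ 3 = 1)%g.
  by rewrite -ft !expgS expg0 mulg1 -!fM mulgA gamma_cube f1.
have st : (s * t * s = t * s * t)%g by rewrite -fs -ft -!fM gamma_braid.
pose X := (s * t^-1)%g; pose Y := (s * X * s^-1)%g; pose W := (t^-1 * s)%g.
have XX : (X * X = quat_center s t)%g by rewrite -(quat_centerXX s3 t3 st) !mulgA.
have YX : (Y * X = quat_center s t * W)%g.
  have -> : (Y * X = s^-1 * t)%g.
    rewrite /Y /X !mulgA mulgVK -(cube_inv s3) -[(_ * t^-1 * t^-1)%g]mulgA.
    by rewrite -[(t^-1 * t^-1)%g]invgK invgM invgK -cube_inv // invgK.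
  have WW : (W * W = quat_center s t)%g by rewrite (quat_centerE s3 t3 st) /W !mulgA.
  by rewrite -(quat_centerV s3 t3 st) -WW invgM mulgVK /W invgM invgK.
rewrite /quat_list !big_cons big_nil addr0 !(fM, fV, f1, fs, ft) rho1 -/X -/Y.
rewrite /quat_sum -/X -/Y -/W XX YX.
have zs : commute (quat_center s t) s := quat_centerCs st.
have zt : commute (quat_center s t) t := quat_centerCt st.
have zX : commute (quat_center s t) X by apply: commuteM => //; exact: commuteV.
have zY : commute (quat_center s t) Y.
  by apply: commuteM; [exact: commuteM|exact: commuteV].
have zW : commute (quat_center s t) W by apply: commuteM => //; exact: commuteV.
have YXz : (Y * (X * quat_center s t) = W)%g.
  by rewrite mulgA YX zW -mulgA (quat_center2 s3 t3 st) mulg1.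
rewrite YXz -zX -zY !(rhoM (quat_center s t)).
rewrite mulrDl mul1r !mulrDr mulr1 !addrA.
by rewrite [LHS](ACl (1*2*5*8*3*4*7*6)%AC).
Qed.

(** * The system in the quotient algebra *)

Section QuotientRing.
Variables (k : fieldType) (n : nat) (hn3 : (3 <= n)%N).
Hypotheses (char2 : 2%N \notin [pchar k]) (char3 : 3%N \notin [pchar k]).

Let rho (g : Gamma n) : kK k hn3 := rq_pi [set q_elt k hn3]%classic (grp_elt k g).

Let rho1 : rho 1%g = 1. Proof. by rewrite /rho grp_elt1 rq_pi1. Qed.
Let rhoM : {morph rho : x y / (x * y)%g >-> x * y}.
Proof. by move=> x y; rewrite /rho grp_eltM rq_piM. Qed.

Let regular p : prime p -> p \notin [pchar k] -> injective (fun x : kK k hn3 => x *+ p).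
Proof.
move=> pp; rewrite inE /= pp /= => p0 x y xy.
have [h hp] : exists h : kK k hn3, h *+ p = 1.
  exists (rq_pi [set q_elt k hn3]%classic (p%:R^-1 *: 1)).
  have piMn z m : rq_pi [set q_elt k hn3]%classic (z *+ m) = rq_pi [set q_elt k hn3]%classic z *+ m.
    by elim: m => [|m IH]; rewrite ?mulr0n ?rq_pi0 // !mulrS rq_piD IH.
  by rewrite -piMn -(scaler_nat p (p%:R^-1 *: 1)) scalerA mulfV // scale1r.
have hK z : h * (z *+ p) = z by rewrite mulrnAr -mulrnAl hp mul1r.
by rewrite -[x]hK xy hK.
Qed.

(** Numbers outside the range of generators give 1. *)
Let gen (i : nat) : Gamma n := oapp (@gamma_gen n) 1%g (insub i).

Let genE i (i4 : (i < n.-1)%N) : gen i = gamma_gen (Ordinal i4).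
Proof. by rewrite /gen insubT. Qed.

(** Only the first four generators occur, so [Gamma n] is handled directly for every n >= 5. *)
Let relatorsP : (5 <= n)%N -> forall l r, (l, r) \in relators -> eval gen l = eval gen r.
Proof.
move=> n5; have lt i : (i < 4)%N -> (i < n.-1)%N.
  by move=> i4; apply: leq_trans i4 _; rewrite -ltnS prednK // (leq_trans _ n5).
have cube i : (i < 4)%N -> (gen i * (gen i * gen i) = 1)%g.
  by move=> /lt i4; rewrite mulgA (genE i4) gamma_cube.
have braid i j : (i < 4)%N -> (j < 4)%N -> j = i.+1 -> (gen i * (gen j * gen i) = gen j * (gen i * gen j))%g.
  by move=> /lt i4 /lt j4 ij; rewrite !mulgA (genE i4) (genE j4) gamma_braid.
have comm i j : (i < 4)%N -> (j < 4)%N -> (i.+2 <= j)%N || (j.+2 <= i)%N -> (gen i * gen j = gen j * gen i)%g.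
  by move=> /lt i4 /lt j4 ij; rewrite (genE i4) (genE j4) gamma_comm.
have ok : all (fun lr => eval gen lr.1 == eval gen lr.2) relators.
  rewrite /= !mulg1 !cube // (braid 0 1)%N // (braid 1 2)%N // (braid 2 3)%N //.
  by rewrite (comm 2 0)%N // (comm 3 0)%N // (comm 3 1)%N // !eqxx.
by move=> l r /(allP ok)/eqP.
Qed.

Let quat0 : quat_sum rho (gen 0) (gen 1) = 0.
Proof.
have nth0 : Gamma_nat hn3 (gamma_gen (ord0 : 'I_3.-1)) = gen 0.
  rewrite Gamma_nat_gen genE; first by apply: leq_trans (gamma_idx_le hn3).
  by move=> lt0; congr gamma_gen; apply: val_inj.
have nth1 : Gamma_nat hn3 (gamma_gen (ord_max : 'I_3.-1)) = gen 1.
  rewrite Gamma_nat_gen genE; first by apply: leq_trans (gamma_idx_le hn3).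
  by move=> lt1; congr gamma_gen; apply: val_inj.
rewrite -(quat_sum_quat_list rho1 rhoM gmulf1 gmulfM (gmulfV _) nth0 nth1).
have qE : q_elt k hn3 = \sum_(g <- quat_list) grp_elt k (Gamma_nat hn3 g).
  by rewrite /q_elt Q_quat_list -fsbig_seq ?uniq_quat_list.
rewrite -(big_morph _ (@rq_piD _ _) (@rq_pi0 _ _)) -qE.
by apply/rq_pi_eq0 => J [_]; apply.
Qed.

Lemma kK_trivial : (5 <= n)%N -> 1 = 0 :> kK k hn3.
Proof.
move=> n5; have := system_transvection_elt (relatorsP n5) quat0.
exact: (ring_trivial rho1 rhoM (@regular 2 isT char2) (@regular 3 isT char3)).
Qed.

End QuotientRing.

Theorem theorem4p8 (k : fieldType) (char2 : 2%N \notin [pchar k])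
    (char3 : 3%N \notin [pchar k]) (n : nat) (hn3 : (3 <= n)%N)
    (hn5 : (5 <= n)%N) :
  forall x : kK k hn3, x = 0.
Proof. by move=> x; rewrite -[x]mul1r (kK_trivial hn3 char2 char3 hn5) mul0r. Qed.
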